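(* Let $\varphi$ be a holomorphic self-map of $\mathbb{B}_N$ and let $\psi$ be a holomorphic function on $\mathbb{B}_N$ such that $W_{\psi,\varphi}$ is bounded on $\mathcal{D}(\mathbb{B}_N)$. Then $W_{\psi,\varphi}$ is Hermitian (self-adjoint) on $\mathcal{D}(\mathbb{B}_N)$ if and only if $\psi(z)=c$ and $\varphi(z)=\varphi'(0)z$ for all $z\in\mathbb{B}_N$, where $c$ is a real constant and $\varphi'(0)$ is a Hermitian matrix.
   Context: $\mathbb{B}_N$ is the open unit ball of $\mathbb{C}^N$ and $\langle\cdot,\cdot\rangle$ is the Euclidean inner product on $\mathbb{C}^N$ (linear in the first variable). $\mathcal{D}(\mathbb{B}_N)$ (the Dirichlet space) is the Hilbert space of holomorphic functions on $\mathbb{B}_N$ with reproducing kernel $K_w(z)=1+\ln\frac{1}{1-\langle z,w\rangle}$, i.e. $f(w)=\langle f,K_w\rangle$ for all $f\in\mathcal{D}(\mathbb{B}_N)$, $w\in\mathbb{B}_N$. $W_{\psi,\varphi}f=\psi\cdot(f\circ\varphi)$. $\varphi'(0)$ is the $N\times N$ complex Jacobian matrix of $\varphi$ at $0$.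
   Formalization: Adds that ψ is not identically 0 and that φ is not a nonzero constant; as stated the claim fails for ψ = 0 with φ nonlinear, and for φ ≡ a ≠ 0 with ψ = K_a, where W f = ⟨f,K_a⟩K_a is self-adjoint. *)

(* Defs.v *)
From mathcomp Require Import all_boot all_order all_algebra.
From mathcomp Require Import complex.
From mathcomp Require Import all_classical all_reals all_analysis.

Set Implicit Arguments.
Unset Strict Implicit.
Unset Printing Implicit Defensive.

Import Order.TTheory GRing.Theory Num.Theory numFieldNormedType.Exports.

(* ring_scope comes last, so that x^* is Num.conj, as in dotmx. *)
Local Open Scope classical_set_scope.
Local Open Scope complex_scope.
Local Open Scope ring_scope.

(* Sealing R[i] as a numClosedFieldType lets it be found as a normed module over
   itself. *)
Definition cplx (R : realType) : numClosedFieldType := R[i].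

(* Points of C^N are row vectors, and the Euclidean inner product is
   dotmx u v = \sum_i u_i * (v_i)^*.  Functions on the ball are total functions
   of which only the values on the ball are meaningful. *)

Definition unit_ball (R : realType) (N : nat) : set 'rV[cplx R]_N :=
  [set z | dotmx z z < 1].

(* Complex differentiability.  The topology on 'rV[cplx R]_N is that of the sup
   norm, which is equivalent to the Euclidean one. *)
Definition holomorphic_on (R : realType) (N : nat) (B : set 'rV[cplx R]_N)
    (f : 'rV[cplx R]_N -> cplx R) : Prop :=
  forall z, B z -> differentiable f z.

Definition holomorphic_self_map (R : realType) (N : nat) (B : set 'rV[cplx R]_N)
    (phi : 'rV[cplx R]_N -> 'rV[cplx R]_N) : Prop :=
  (forall z, B z -> differentiable phi z) /\ (forall z, B z -> B (phi z)).

(* Principal argument, in ]-pi, pi] for x != 0. *)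
Definition carg (R : realType) (x : cplx R) : R :=
  let t := acos (complex.Re x / Normc.normc x) in
  if 0 <= complex.Im x then t else - t.

Definition clog (R : realType) (x : cplx R) : cplx R :=
  ln (Normc.normc x) +i* carg x.

Definition dirichlet_kernel (R : realType) (N : nat) (w z : 'rV[cplx R]_N) :
    cplx R :=
  1 + clog (1 / (1 - dotmx z w)).

Definition hnorm (R : realType) (X : Type)
    (ip : (X -> cplx R) -> (X -> cplx R) -> cplx R) (f : X -> cplx R) : R :=
  Num.sqrt (complex.Re (ip f f)).

(* D, with inner product ip, is a complex Hilbert space of functions on B.
   Since total functions stand for functions on B, membership in D only depends
   on the values on B, and the zero vector is any function vanishing on B. *)
Record hilbert_function_space (R : realType) (X : Type) (B : set X)
    (D : set (X -> cplx R)) (ip : (X -> cplx R) -> (X -> cplx R) -> cplx R) : Prop := {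
  hfs_ext : forall f g : X -> cplx R,
    D f -> (forall z, B z -> f z = g z) -> D g;
  hfs_zero : D (fun=> 0);
  hfs_linear : forall (a : cplx R) (f g : X -> cplx R),
    D f -> D g -> D (fun z => a * f z + g z);
  hfs_ip_linear : forall (a : cplx R) (f g h : X -> cplx R), D f -> D g -> D h ->
    ip (fun z => a * f z + g z) h = a * ip f h + ip g h;
  hfs_ip_conj : forall f g : X -> cplx R, D f -> D g -> ip g f = (ip f g)^*;
  hfs_ip_ge0 : forall f : X -> cplx R, D f -> 0 <= ip f f;
  hfs_ip_eq0 : forall f : X -> cplx R, D f ->
    (ip f f = 0 <-> forall z, B z -> f z = 0);
  hfs_complete : forall u : nat -> X -> cplx R, (forall n, D (u n)) ->
    (forall e : R, 0 < e -> exists n0 : nat, forall m n : nat,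
       (n0 <= m)%N -> (n0 <= n)%N ->
       hnorm ip (fun z => u m z - u n z) < e) ->
    exists2 f : X -> cplx R, D f &
      hnorm ip (fun z => u n z - f z) @[n --> \oo] --> (0 : R)
}.

(* By uniqueness of the Hilbert space with a given reproducing kernel, this
   determines D, and ip on D. *)
Record dirichlet_space (R : realType) (N : nat)
    (D : set ('rV[cplx R]_N -> cplx R))
    (ip : ('rV[cplx R]_N -> cplx R) -> ('rV[cplx R]_N -> cplx R) -> cplx R) : Prop := {
  ds_hilbert : hilbert_function_space (@unit_ball R N) D ip;
  ds_holomorphic : forall f, D f -> holomorphic_on (@unit_ball R N) f;
  ds_kernel : forall w, unit_ball w -> D (dirichlet_kernel w);
  ds_reproducing : forall f w, D f -> unit_ball w ->
    f w = ip f (dirichlet_kernel w)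
}.

Definition weighted_composition (R : realType) (X : Type) (psi : X -> cplx R)
    (phi : X -> X) (f : X -> cplx R) : X -> cplx R :=
  fun z => psi z * f (phi z).

Definition bounded_operator (R : realType) (X : Type) (D : set (X -> cplx R))
    (ip : (X -> cplx R) -> (X -> cplx R) -> cplx R)
    (T : (X -> cplx R) -> (X -> cplx R)) : Prop :=
  (forall f, D f -> D (T f)) /\
  exists M : R, forall f, D f -> hnorm ip (T f) <= M * hnorm ip f.

Definition hermitian_operator (R : realType) (X : Type) (D : set (X -> cplx R))
    (ip : (X -> cplx R) -> (X -> cplx R) -> cplx R)
    (T : (X -> cplx R) -> (X -> cplx R)) : Prop :=
  forall f g, D f -> D g -> ip (T f) g = ip f (T g).

(* The Jacobian matrix in the usual convention, with entry (i, j) the j-th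
   partial derivative of phi_i; the library's 'J acts on row vectors from the
   right and is the transpose of it. *)
Definition jacobian_matrix (R : realType) (N : nat)
    (phi : 'rV[cplx R]_N -> 'rV[cplx R]_N) (a : 'rV[cplx R]_N) : 'M[cplx R]_N :=
  ('J phi a)^T.

(* Main.v *)
(* The kernel is K_w(z) = L(<z,w>) with L(x) = 1 - log(1 - x).  Testing on kernel
   functions (and, for the converse, taking the adjoint from Riesz'
   representation theorem), W is Hermitian if and only if
     psi(z) L(<phi(z),w>) = conj(psi(w)) L(<z,phi(w)>)   for all z, w.
   With a = phi(0), putting w = 0 gives psi(z) = c L(<z,a>), c real, whence
     L(<z,a>) L(<phi(z),w>) = L(<a,w>) L(<z,phi(w)>).
   Differentiating along t z at t = 0 yields
     <z,phi(w)> = <z,a> + (L'/L)(<a,w>) <Az,w>,  A = phi'(0),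
   and then A is Hermitian.  If a = 0, phi = A and psi = c.  If a <> 0 and
   A <> 0, there is a direction v with <v,a> > 0 and <Av,v> real nonzero, and for
   z, w real multiples of v the identity reads
     L(x) L(y + h(x) u) = L(y) L(x + h(y) u),  h = L'/L,  u = kappa x y,
   for small real x and y.  For y < 0 < x this contradicts the strict convexity
   of log L on [0,1[ and its strict concavity on ]-1,0].  So A = 0, and phi is
   constant. *)

Require Import Defs.
From mathcomp Require Import all_boot all_order all_algebra.
From mathcomp Require Import complex.
From mathcomp Require Import all_classical all_reals all_analysis.
From mathcomp Require Import ring lra.

Import Order.TTheory GRing.Theory Num.Theory numFieldNormedType.Exports.
Local Open Scope classical_set_scope.
Local Open Scope complex_scope.
Local Open Scope ring_scope.

Set Implicit Arguments.
Unset Strict Implicit.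
Unset Printing Implicit Defensive.

(** Stated over any [numFieldType], so that it serves both the real derivative of [ln] and the
    complex derivative of [clog]. *)
Lemma is_derive1_chain (K : numFieldType) (f g : K -> K) (x a b : K) :
  is_derive (g x) 1 f a -> is_derive x 1 g b -> is_derive x 1 (f \o g) (a * b).
Proof.
move=> [df' <-] [dg' <-].
have /derivable1_diffP df := df'; have /derivable1_diffP dg := dg'.
have dfg : differentiable (f \o g) x by exact: differentiable_comp.
apply: DeriveDef; first exact/derivable1_diffP.
rewrite (deriveE _ dfg) diff_comp// /comp deriv1E//.
rewrite -(deriveE _ dg) derive1E.
exact: mulrC.
Qed.

(** * The kernel on the real axis *)

Section real_kernel.
Variable R : realType.
Implicit Types x y s t : R.

Lemma ltr_ln_subr1 x : 0 < x -> x != 1 -> ln x < x - 1.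
Proof.
move=> x0 x1; rewrite -ltr_expR lnK ?posrE//.
have := @expR_gt1Dx R (x - 1); rewrite subr_eq0 => /(_ x1).
by rewrite addrC subrK.
Qed.

(** The function L at real arguments; [cker_real] identifies it on ]-1, 1[ with the complex one. *)
Definition rker x : R := 1 - ln (1 - x).

(* The logarithmic derivative L'/L of L = rker. *)
Definition rker_dlog x : R := ((1 - x) * rker x)^-1.

Lemma rker_gt0 x : -1 < x -> x < 1 -> 0 < rker x.
Proof.
move=> xN1 x1; rewrite subr_gt0.
have [->|n1] := eqVneq (1 - x) 1; first by rewrite ln1.
have /ltr_ln_subr1 : 0 < 1 - x by lra.
by move=> /(_ n1); lra.
Qed.

Lemma rker_dlog_gt0 x : -1 < x -> x < 1 -> 0 < rker_dlog x.
Proof. by move=> xN1 x1; rewrite invr_gt0 mulr_gt0 ?rker_gt0// subr_gt0. Qed.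

Lemma ln_subr x y : 0 < x -> 0 < y -> ln y = ln x + ln (y / x).
Proof. by move=> x0 y0; rewrite ln_div ?posrE//; ring. Qed.

(** The reciprocal (1 - t) L(t) has derivative ln(1 - t) <= 0 on [0, 1[. No derivative is taken: ln
    r < r - 1 at r = (1 - x) / (1 - y) gives the strict decrease. *)
Lemma rker_dlog_incr x y : 0 <= x -> x < y -> y < 1 -> rker_dlog x < rker_dlog y.
Proof.
move=> x0 xy y1.
rewrite /rker_dlog ltf_pV2 ?posrE ?mulr_gt0 ?rker_gt0 ?subr_gt0//; try lra.
rewrite /rker.
have sx : 0 < 1 - x by lra. have sy : 0 < 1 - y by lra.
have e := ln_subr sy sx.
have lx : ln (1 - x) <= 0 by rewrite ln_le0//; lra.
have : ln ((1 - x) / (1 - y)) < (1 - x) / (1 - y) - 1.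
  apply: ltr_ln_subr1; first by rewrite divr_gt0.
  by rewrite gt_eqF// ltr_pdivlMr//; lra.
(* Clearing the denominator 1 - y leaves (y - x) ln(1 - x) as the only product whose sign must be
   supplied. *)
rewrite -(ltr_pM2l sy).
set r := ln (_ / _) in e *; set a := ln (1 - x) in e lx *.
set b := ln (1 - y) in e *.
have -> : (1 - y) * ((1 - x) / (1 - y) - 1) = y - x by field; lra.
have -> : b = a - r by lra.
have : 0 <= (y - x) * - a by rewrite mulr_ge0//; lra.
lra.
Qed.

(** On ]-1, 0] the derivative ln(1 - t) of (1 - t) L(t) is nonnegative, which reverses the
    monotonicity of [rker_dlog_incr]. *)
Lemma rker_dlog_decr x y : -1 < x -> x < y -> y <= 0 -> rker_dlog y < rker_dlog x.
Proof.
move=> xN1 xy y0.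
rewrite /rker_dlog ltf_pV2 ?posrE ?mulr_gt0 ?rker_gt0 ?subr_gt0//; try lra.
rewrite /rker.
have sx : 0 < 1 - x by lra. have sy : 0 < 1 - y by lra.
have e := ln_subr sx sy.
have ly : 0 <= ln (1 - y) by rewrite ln_ge0//; lra.
have : ln ((1 - y) / (1 - x)) < (1 - y) / (1 - x) - 1.
  apply: ltr_ln_subr1; first by rewrite divr_gt0.
  by rewrite lt_eqF// ltr_pdivrMr//; lra.
rewrite -(ltr_pM2l sx).
set r := ln (_ / _) in e *; set a := ln (1 - x) in e *.
set b := ln (1 - y) in e ly *.
have -> : (1 - x) * ((1 - y) / (1 - x) - 1) = x - y by field; lra.
have -> : a = b - r by lra.
have : 0 <= (y - x) * b by rewrite mulr_ge0//; lra.
lra.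
Qed.

(** For x >= 0 the factors of (1 - x) L(x) are at least 1/2 and 1; for x < 0 they are at least 1 and
    1/2. The bound sizes the test points in [jacobian_eq0]. *)
Lemma rker_dlog_bounds x : - 2^-1 <= x -> x <= 2^-1 -> 0 < rker_dlog x <= 2.
Proof.
move=> x1 x2.
have l0 : 2^-1 <= (1 - x) * rker x.
  rewrite /rker; have [x0|x0] := leP 0 x.
    have : ln (1 - x) <= 0 by rewrite ln_le0//; lra.
    by set l := ln _ => l0; nra.
  have : ln (1 + (- x)) <= - x by apply: le_ln1Dx; lra.
  have : 0 <= ln (1 - x) by rewrite ln_ge0//; lra.
  by set l := ln _ => l0 l1; nra.
apply/andP; split; first by rewrite invr_gt0; lra.
by rewrite -[leRHS]invrK lef_pV2// posrE; lra.
Qed.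

Lemma is_derive_ln_rker x : -1 < x -> x < 1 ->
  is_derive x 1 (fun t => ln (rker t)) (rker_dlog x).
Proof.
move=> xN1 x1.
have dl : is_derive (1 - x) 1 (@ln R) (1 - x)^-1 by apply: is_derive1_ln; lra.
have dL : is_derive (rker x) 1 (@ln R) (rker x)^-1.
  by apply: is_derive1_ln; apply: rker_gt0.
have d1 : is_derive x 1 (fun t : R => 1 - t) (-1).
  by apply: is_derive_eq; ring.
have d2 := @is_derive1_chain R (@ln R) (fun t => 1 - t) _ _ _ dl d1.
have d3 : is_derive x 1 rker (1 - x)^-1.
  by apply: is_derive_eq; ring.
by have := @is_derive1_chain R (@ln R) rker _ _ _ dL d3; rewrite /rker_dlog invfM mulrC.
Qed.

(** Strict convexity of log L on [0, 1[ in tangent form: the mean value theorem gives an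
    intermediate slope, which [rker_dlog_incr] compares with the slope at x. *)
Lemma ln_rker_tangent_pos x y : 0 <= x -> x < 1 -> 0 <= y -> y < 1 -> x != y ->
  (y - x) * rker_dlog x < ln (rker y) - ln (rker x).
Proof.
move=> x0 x1 y0 y1; rewrite neq_lt => /orP[xy|yx].
  have [||c] := @MVT R (@ln R \o rker) rker_dlog x y xy.
  - move=> t; rewrite in_itv/= => /andP[? ?]; apply: is_derive_ln_rker; lra.
  - apply: derivable_within_continuous => t; rewrite in_itv/= => /andP[? ?].
    by have [] : is_derive t 1 (@ln R \o rker) (rker_dlog t) by apply: is_derive_ln_rker; lra.
  rewrite in_itv/= => /andP[xc cy] ->.
  by rewrite mulrC ltr_pM2r ?subr_gt0// rker_dlog_incr//; lra.
have [||c] := @MVT R (@ln R \o rker) rker_dlog y x yx.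
- move=> t; rewrite in_itv/= => /andP[? ?]; apply: is_derive_ln_rker; lra.
- apply: derivable_within_continuous => t; rewrite in_itv/= => /andP[? ?].
  by have [] : is_derive t 1 (@ln R \o rker) (rker_dlog t) by apply: is_derive_ln_rker; lra.
rewrite in_itv/= => /andP[yc cx] /= e.
have h : rker_dlog c < rker_dlog x by apply: rker_dlog_incr; lra.
have : rker_dlog c * (x - y) < rker_dlog x * (x - y) by rewrite ltr_pM2r ?subr_gt0.
lra.
Qed.

(** Strict concavity of log L on ]-1, 0], in the same tangent form. *)
Lemma ln_rker_tangent_neg x y : -1 < x -> x <= 0 -> -1 < y -> y <= 0 -> x != y ->
  ln (rker y) - ln (rker x) < (y - x) * rker_dlog x.
Proof.
move=> x0 x1 y0 y1; rewrite neq_lt => /orP[xy|yx].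
  have [||c] := @MVT R (@ln R \o rker) rker_dlog x y xy.
  - move=> t; rewrite in_itv/= => /andP[? ?]; apply: is_derive_ln_rker; lra.
  - apply: derivable_within_continuous => t; rewrite in_itv/= => /andP[? ?].
    by have [] : is_derive t 1 (@ln R \o rker) (rker_dlog t) by apply: is_derive_ln_rker; lra.
  rewrite in_itv/= => /andP[xc cy] ->.
  by rewrite [ltRHS]mulrC ltr_pM2r ?subr_gt0// rker_dlog_decr//; lra.
have [||c] := @MVT R (@ln R \o rker) rker_dlog y x yx.
- move=> t; rewrite in_itv/= => /andP[? ?]; apply: is_derive_ln_rker; lra.
- apply: derivable_within_continuous => t; rewrite in_itv/= => /andP[? ?].
  by have [] : is_derive t 1 (@ln R \o rker) (rker_dlog t) by apply: is_derive_ln_rker; lra.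
rewrite in_itv/= => /andP[yc cx] /= e.
have h : rker_dlog x < rker_dlog c by apply: rker_dlog_decr; lra.
have : rker_dlog x * (x - y) < rker_dlog c * (x - y) by rewrite ltr_pM2r ?subr_gt0.
lra.
Qed.

(** With h = [rker_dlog], the tangents at y and at x have the same increment h(x) h(y) u. Concavity
    puts ln L(y + h(x) u) - ln L(y) strictly below it, convexity puts ln L(x + h(y) u) - ln L(x)
    strictly above it. *)
Lemma rker_eq_contra x y u : 0 < x -> x < 1 -> -1 < y -> y < 0 -> u != 0 ->
  -1 < y + rker_dlog x * u <= 0 -> 0 <= x + rker_dlog y * u < 1 ->
  rker x * rker (y + rker_dlog x * u) != rker y * rker (x + rker_dlog y * u).
Proof.
move=> x0 x1 yN1 y0 u0 /andP[p1 p2] /andP[q1 q2].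
have hx : rker_dlog x != 0 by rewrite gt_eqF// rker_dlog_gt0//; lra.
have hy : rker_dlog y != 0 by rewrite gt_eqF// rker_dlog_gt0//; lra.
have := @ln_rker_tangent_neg y (y + rker_dlog x * u).
rewrite -subr_eq0 addrAC opprD addNKr oppr_eq0 mulf_neq0// => /(_ yN1 (ltW y0) p1 p2 isT).
have := @ln_rker_tangent_pos x (x + rker_dlog y * u).
rewrite -subr_eq0 addrAC opprD addNKr oppr_eq0 mulf_neq0// => /(_ (ltW x0) x1 q1 q2 isT).
move=> h1 h2; apply/eqP => /(congr1 (@ln R)).
rewrite !lnM ?posrE ?rker_gt0//; lra.
Qed.

End real_kernel.

(** * Riesz' representation theorem *)

Lemma normc_nneg (R : realType) (x : cplx R) : 0 <= Normc.normc x.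
Proof. by case: x => a b; rewrite sqrtr_ge0. Qed.

(** The multiplier t conj(d) turns the cross term of a Hermitian form into t |d|^2, which reduces
    complex estimates to a quadratic in a real t. *)
Lemma scaled_conj_sq (R : realType) (t : R) (d : cplx R) :
  Normc.normc (t%:C * d^*) ^+ 2 = t ^+ 2 * Normc.normc d ^+ 2 /\
  complex.Re (t%:C * d^* * d) = t * Normc.normc d ^+ 2.
Proof.
have sq (u v : R) : Num.sqrt (u ^+ 2 + v ^+ 2) ^+ 2 = u ^+ 2 + v ^+ 2.
  by rewrite sqr_sqrtr// addr_ge0 ?sqr_ge0.
by case: d => a b; split; rewrite /= !sq; ring.
Qed.

Lemma conj_realC (R : realType) (r : R) : (r%:C : cplx R)^* = r%:C.
Proof. exact: conjc_real. Qed.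

Lemma conj_fixed_real (R : realType) (x : cplx R) : x^* = x -> x = (complex.Re x)%:C.
Proof.
case: x => a b e; have : - b = b by case: e.
by move=> ?; have -> : b = 0 by lra.
Qed.

(** For F > 0 the quadratic is evaluated at t = -1/F, where it is smallest; for F = 0 and n > 0 the
    chosen t gives the value -1. *)
Lemma quadratic_ge0 (R : realType) (n F G : R) : 0 <= n -> 0 <= F ->
  (forall t : R, 0 <= t ^+ 2 * n * F + 2 * t * n + G) -> n <= F * G.
Proof.
move=> n0 F0 key.
have [F1|F1] := eqVneq F 0.
  rewrite F1 mul0r leNgt; apply/negP => n1.
  have := key (- (G + 1) / (2 * n)); rewrite F1 mulr0 add0r.
  have -> : 2 * (- (G + 1) / (2 * n)) * n = - (G + 1) by field; rewrite gt_eqF.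
  lra.
have F2 : 0 < F by rewrite lt_def F1.
have := key (- F^-1).
have -> : (- F^-1) ^+ 2 * n * F + 2 * - F^-1 * n + G = G - n / F by field.
by rewrite subr_ge0 ler_pdivrMr// mulrC.
Qed.

Section riesz.
Variables (R : realType) (X : Type) (B : set X) (D : set (X -> cplx R)).
Variable ip : (X -> cplx R) -> (X -> cplx R) -> cplx R.
Hypothesis hD : hilbert_function_space B D ip.
Implicit Types (f g h : X -> cplx R) (a b : cplx R).

Let inD a f g : D f -> D g -> D (fun z => a * f z + g z).
Proof. exact: hfs_linear hD _ _ _. Qed.

Lemma hfs_ip_linearr a f g h : D f -> D g -> D h ->
  ip h (fun z => a * f z + g z) = a^* * ip h f + ip h g.
Proof.
move=> Df Dg Dh.
rewrite (hfs_ip_conj hD (inD a Df Dg) Dh) (hfs_ip_conj hD Df Dh).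
by rewrite (hfs_ip_conj hD Dg Dh) (hfs_ip_linear hD)// rmorphD rmorphM.
Qed.

Definition nsq f : R := complex.Re (ip f f).

Lemma nsqE f : D f -> (nsq f)%:C = ip f f.
Proof. by move=> Df; apply: RRe_real; apply: ger0_real; apply: hfs_ip_ge0 hD _ Df. Qed.

Lemma nsq_ge0 f : D f -> 0 <= nsq f.
Proof. by move=> Df; rewrite -(@lecR R) nsqE//; apply: (hfs_ip_ge0 hD Df). Qed.

Lemma nsqD a f g : D f -> D g ->
  nsq (fun z => a * f z + g z) =
  Normc.normc a ^+ 2 * nsq f + 2 * complex.Re (a * ip f g) + nsq g.
Proof.
move=> Df Dg; rewrite /nsq.
rewrite (hfs_ip_linear hD) ?hfs_ip_linearr//; last exact: inD.
rewrite (hfs_ip_conj hD Df Dg).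
have -> : complex.Re (ip f f) = nsq f by [].
have := nsqE Df; move: (ip f f) (ip f g) (ip g g) (nsq f) => c [d1 d2] [e1 e2] n <-.
case: a => a1 a2 /=.
rewrite sqr_sqrtr ?addr_ge0 ?sqr_ge0//=.
by ring.
Qed.

Lemma ip0l f g : (forall z, f z = 0) -> D g -> ip f g = 0.
Proof.
move=> f0 Dg; have -> : f = (fun z => (-1) * g z + g z).
  by apply/funext => z; rewrite f0 mulN1r addNr.
by rewrite (hfs_ip_linear hD)// mulN1r addNr.
Qed.

(** The squared norm of t conj(<f,g>) f + g is nonnegative for every real t. *)
Lemma cauchy_schwarz f g : D f -> D g ->
  Normc.normc (ip f g) ^+ 2 <= nsq f * nsq g.
Proof.
move=> Df Dg; apply: quadratic_ge0; rewrite ?sqr_ge0 ?nsq_ge0// => t.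
have := nsq_ge0 (inD (t%:C * (ip f g)^*) Df Dg).
have [e1 e2] := scaled_conj_sq t (ip f g).
by rewrite nsqD// e1 e2 (mulrA 2).
Qed.

Lemma hnorm_ge0 f : 0 <= hnorm ip f.
Proof. exact: sqrtr_ge0. Qed.

Lemma sqr_hnorm f : D f -> hnorm ip f ^+ 2 = nsq f.
Proof. by move=> Df; rewrite sqr_sqrtr ?nsq_ge0. Qed.

Lemma normc_ip_le f g : D f -> D g ->
  Normc.normc (ip f g) <= hnorm ip f * hnorm ip g.
Proof.
move=> Df Dg; rewrite -ler_sqr ?nnegrE ?mulr_ge0 ?hnorm_ge0// ?normc_nneg//.
by rewrite exprMn !sqr_hnorm// cauchy_schwarz.
Qed.

Lemma inD_sub f g : D f -> D g -> D (fun z => f z - g z).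
Proof.
move=> Df Dg; have -> : (fun z => f z - g z) = (fun z => (-1) * g z + f z).
  by apply/funext => z; rewrite mulN1r addrC.
exact: inD.
Qed.

Section representation.
Variables (l : (X -> cplx R) -> cplx R) (C : R).
Hypothesis l_lin : forall a f g, D f -> D g ->
  l (fun z => a * f z + g z) = a * l f + l g.
Hypothesis l_bnd : forall f, D f -> Normc.normc (l f) <= C * hnorm ip f.

(** If l = <., h>, then J f = |f - h|^2 - |h|^2, so the representative of l is the minimizer of
    J. *)
Let J f : R := nsq f - 2 * complex.Re (l f).

(** Completing the square in |f|^2 - 2 C |f|. *)
Let J_ge f : D f -> - C ^+ 2 <= J f.
Proof.
move=> Df; rewrite /J -sqr_hnorm//.
have h : complex.Re (l f) <= C * hnorm ip f.
  apply: le_trans (l_bnd Df); case: (l f) => a b /=.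
  apply: le_trans (ler_norm a) _.
  by rewrite -sqrtr_sqr ler_wsqrtr// lerDl sqr_ge0.
have := sqr_ge0 (hnorm ip f - C); rewrite sqrrB; lra.
Qed.

Let JD a f g : D f -> D g -> J (fun z => a * f z + g z) =
  J g + Normc.normc a ^+ 2 * nsq f + 2 * complex.Re (a * (ip f g - l f)).
Proof.
move=> Df Dg; rewrite /J nsqD// l_lin// mulrBr.
move: (l f) (l g) (ip f g) => [? ?] [? ?] [? ?]; case: a => ? ? /=; ring.
Qed.

(* A near minimizer f of J represents l up to an error: JD bounds
   t^2 |d|^2 nsq g + 2 t |d|^2 below by -e^2 for all t, d = ip g f - l g. *)
Let approx (e : R) : 0 < e -> exists2 f, D f &
  forall g, D g -> Normc.normc (ip g f - l g) <= hnorm ip g * e.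
Proof.
move=> e0; pose S := [set J f | f in D].
have S0 : has_inf S.
  split; first by exists (J (fun=> 0)), (fun=> 0) => //; exact: hfs_zero hD.
  by exists (- C ^+ 2) => _ [f Df <-]; exact: J_ge.
have [_ [f Df <-] Jf] := inf_adherent (exprn_gt0 2 e0) S0.
exists f => // g Dg.
rewrite -ler_sqr ?nnegrE ?mulr_ge0 ?hnorm_ge0 ?normc_nneg ?(ltW e0)//.
rewrite exprMn sqr_hnorm//; apply: quadratic_ge0; rewrite ?sqr_ge0 ?nsq_ge0// => t.
have [e1 e2] := scaled_conj_sq t (ip g f - l g).
have := JD (t%:C * (ip g f - l g)^*) Dg Df; rewrite e1 e2.
have : inf S <= J (fun z => t%:C * (ip g f - l g)^* * g z + f z).
  by apply: ge_inf; [case: S0|exists (fun z => t%:C * (ip g f - l g)^* * g z + f z) => //; exact: inD].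
by move: Jf => /= Jf h1 h2; lra.
Qed.

(** The approximate representatives [u k] form a Cauchy sequence, and their limit represents l
    because the errors tend to 0. *)
Lemma riesz_representation : exists2 h, D h & forall f, D f -> l f = ip f h.
Proof.
have e0 k : 0 < k.+1%:R^-1 :> R by rewrite invr_gt0.
pose u k := projT1 (cid2 (approx (e0 k))).
have Du k : D (u k) by rewrite /u; case: cid2.
have ul k g : D g -> Normc.normc (ip g (u k) - l g) <= hnorm ip g * k.+1%:R^-1.
  by rewrite /u; case: cid2 => /= ? _; exact.
have uD m n : hnorm ip (fun z => u m z - u n z) <= m.+1%:R^-1 + n.+1%:R^-1.
  set g := fun z => _; have Dg : D g by exact: inD_sub.
  (* Here |g|^2 = <g, u m> - <g, u n>, and [l g] cancels between the two errors; the common factor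
     |g| is divided out afterwards. *)
  have : hnorm ip g * hnorm ip g <= hnorm ip g * (m.+1%:R^-1 + n.+1%:R^-1).
    rewrite -expr2 (sqr_hnorm Dg).
    have e : ip g (u m) - ip g (u n) = ip g g.
      have -> : u m = (fun z => 1 * g z + u n z).
        by apply/funext => z; rewrite mul1r subrK.
      by rewrite hfs_ip_linearr// conjC1 mul1r addrK.
    have : nsq g <= Normc.normc (ip g g).
      have := nsqE Dg; case: (ip g g) => a b [<- <-] /=.
      by rewrite expr0n addr0 sqrtr_sqr ler_norm.
    move=> /le_trans; apply.
    rewrite -e.
    have -> : ip g (u m) - ip g (u n) =
       (ip g (u m) - l g) + - (ip g (u n) - l g) by ring.
    apply: le_trans (le_normcD _ _) _.
    by rewrite normcN mulrDr lerD// ul.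
  have := hnorm_ge0 g; rewrite le_eqVlt => /orP[/eqP <-|g0].
    by move=> _; apply: addr_ge0; apply: ltW.
  by rewrite ler_pM2l.
have [e e_gt0|h Dh hu] := hfs_complete hD Du.
  have e2_gt0 : 0 < e / 2 by lra.
  have [n0 _ n0P] := near_infty_natSinv_lt (PosNum e2_gt0).
  exists n0 => m n hm hn; apply: le_lt_trans (uD m n) _.
  have h1 : m.+1%:R^-1 < e / 2 := n0P _ hm.
  have h2 : n.+1%:R^-1 < e / 2 := n0P _ hn.
  by rewrite [ltRHS]splitr ltrD.
exists h => // g Dg.
have key k : Normc.normc (l g - ip g h) <=
    hnorm ip g * (hnorm ip (fun z => u k z - h z) + k.+1%:R^-1).
  have D1 : D (fun z => u k z - h z) by exact: inD_sub.
  have e : ip g (u k) = ip g (fun z => u k z - h z) + ip g h.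
    have -> : ip g (u k) = ip g (fun z => 1 * (u k z - h z) + h z).
      by congr ip; apply/funext => z; rewrite mul1r subrK.
    by rewrite hfs_ip_linearr// conjC1 mul1r.
  have -> : l g - ip g h =
    ip g (fun z => u k z - h z) + - (ip g (u k) - l g) by rewrite e; ring.
  apply: le_trans (le_normcD _ _) _.
  by rewrite normcN mulrDr lerD ?ul ?normc_ip_le.
suff : Normc.normc (l g - ip g h) <= hnorm ip g * (0 + 0).
  rewrite addr0 mulr0 => le0.
  apply/eqP; rewrite -subr_eq0; apply/eqP; apply: Normc.eq0_normc.
  by apply/eqP; rewrite eq_le le0 normc_nneg.
have c : hnorm ip g * (hnorm ip (fun z => u k z - h z) + k.+1%:R^-1)
    @[k --> \oo] --> hnorm ip g * (0 + 0).
  by apply: cvgMl_tmp; apply: cvgD => //; exact: cvg_harmonic.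
by apply: (cvgr_to_ge c); exact: nearW key.
Qed.

End representation.
End riesz.

(** * The complex logarithm on the right half-plane *)

Section complex_log.
Variable R : realType.
Implicit Types (x y : cplx R) (s t r : R).

(** By the half-angle formula cos t = 1 - 2 sin(t/2)^2, and the sine does not vanish strictly
    between 0 and pi. *)
Lemma cos_eq1 t : `|t| < 2 * pi -> cos t = 1 -> t = 0.
Proof.
move=> tpi; have [//|t0] := eqVneq t 0.
have -> : cos t = 1 - 2 * sin (t / 2) ^+ 2.
  rewrite -[in LHS](_ : t / 2 + t / 2 = t); last by field.
  by rewrite cosD -!expr2 sin2cos2; ring.
have : sin (`|t| / 2) != 0.
  rewrite gt_eqF// sin_gt0_pi// divr_gt0 ?normr_gt0//=.
  by rewrite ltr_pdivrMr// mulrC.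
have -> : (sin (`|t| / 2) != 0) = (sin (t / 2) != 0).
  by have [t1|t1] := ger0P t; rewrite ?mulNr ?sinN ?oppr_eq0.
by rewrite -sqrf_eq0 => /eqP h1 h2; exfalso; apply: h1; lra.
Qed.

Lemma normcE x : Normc.normc x ^+ 2 = complex.Re x ^+ 2 + complex.Im x ^+ 2.
Proof. by case: x => a b; rewrite sqr_sqrtr// addr_ge0 ?sqr_ge0. Qed.

Lemma normc_gt0 x : x != 0 -> 0 < Normc.normc x.
Proof.
move=> x0; rewrite lt_def normc_nneg andbT; apply: contraNneq x0.
by move/Normc.eq0_normc => ->.
Qed.

Lemma Re_div_normc x : x != 0 -> -1 <= complex.Re x / Normc.normc x <= 1.
Proof.
move=> /normc_gt0 x0; rewrite -ler_norml normrM normfV (gtr0_norm x0).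
rewrite ler_pdivrMr// mul1r -ler_sqr ?nnegrE ?normc_nneg// normcE.
by rewrite real_normK ?num_real// lerDl sqr_ge0.
Qed.

Lemma carg_polar x : x != 0 ->
  complex.Re x = Normc.normc x * cos (carg x) /\
  complex.Im x = Normc.normc x * sin (carg x).
Proof.
move=> x0; have nx := normc_gt0 x0; have rx := Re_div_normc x0.
have c : Normc.normc x * (complex.Re x / Normc.normc x) = complex.Re x.
  by rewrite mulrC divfK// gt_eqF.
have s : Normc.normc x * Num.sqrt (1 - (complex.Re x / Normc.normc x) ^+ 2) =
    `|complex.Im x|.
  have -> : 1 - (complex.Re x / Normc.normc x) ^+ 2 =
      (complex.Im x / Normc.normc x) ^+ 2.
    have := normcE x; move: nx; move: (Normc.normc x) => n n0 e.
    transitivity ((n ^+ 2 - complex.Re x ^+ 2) / n ^+ 2); first by field; rewrite gt_eqF.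
    by rewrite expr_div_n e addrAC subrr add0r.
  by rewrite sqrtr_sqr normrM normfV (gtr0_norm nx) mulrC divfK// gt_eqF.
rewrite /carg; case: leP => Im0.
  by rewrite acosK ?in_itv//= sin_acos// c s ger0_norm.
by rewrite cosN sinN acosK ?in_itv//= sin_acos// mulrN c s ltr0_norm// opprK.
Qed.

Lemma Re_gt0_neq0 x : 0 < complex.Re x -> x != 0.
Proof. by apply: contraTneq => ->; rewrite ltxx. Qed.

Lemma carg_bound x : 0 < complex.Re x -> `|carg x| < pi / 2.
Proof.
move=> Rx; have x0 := Re_gt0_neq0 Rx; have rx := Re_div_normc x0.
have -> : `|carg x| = acos (complex.Re x / Normc.normc x).
  by rewrite /carg; case: ifP; rewrite ?normrN ger0_norm// acos_ge0.
rewrite ltNge; apply/negP => h.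
have : cos (acos (complex.Re x / Normc.normc x)) <= cos (pi / 2).
  rewrite leNgt; apply/negP; rewrite ltr_cos ?in_itv/= ?acos_ge0 ?acos_lepi//.
    by rewrite ltNge h.
  have := pi_gt0 R; lra.
by rewrite cos_pihalf acosK ?in_itv//= leNgt divr_gt0// normc_gt0.
Qed.

(** The two angles share cosine and sine, so their difference has cosine 1 and is less than a full
    turn. *)
Lemma carg_uniq x t : x != 0 ->
  complex.Re x = Normc.normc x * cos t -> complex.Im x = Normc.normc x * sin t ->
  `|t - carg x| < 2 * pi -> carg x = t.
Proof.
move=> x0 ex ey b; have [ex' ey'] := carg_polar x0.
have nx : Normc.normc x != 0 by rewrite gt_eqF// normc_gt0.
apply/eqP; rewrite eq_sym -subr_eq0; apply/eqP; apply: cos_eq1 => //.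
rewrite cosB.
have -> : cos t = cos (carg x) by apply: (mulfI nx); rewrite -ex -ex'.
have -> : sin t = sin (carg x) by apply: (mulfI nx); rewrite -ey -ey'.
by rewrite -!expr2 cos2Dsin2.
Qed.

(** All three arguments are below pi/2 in absolute value, so arg x + arg y differs from arg(xy) by
    less than 2 pi and [carg_uniq] applies. *)
Lemma clogM x y : 0 < complex.Re x -> 0 < complex.Re y ->
  0 < complex.Re (x * y) -> clog (x * y) = clog x + clog y.
Proof.
move=> Rx Ry Rxy; have := carg_bound Rx; have := carg_bound Ry; have := carg_bound Rxy.
have x0 := Re_gt0_neq0 Rx; have y0 := Re_gt0_neq0 Ry.
have [ex ey] := carg_polar x0; have [ex' ey'] := carg_polar y0.
move=> b1 b2 b3; rewrite /clog Normc.normcM lnM ?posrE ?normc_gt0//.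
have -> : carg (x * y) = carg x + carg y.
  apply: carg_uniq; first exact: Re_gt0_neq0.
  - rewrite Normc.normcM cosD.
    transitivity (complex.Re x * complex.Re y - complex.Im x * complex.Im y).
      by case: (x) (y) => ? ? [].
    by rewrite ex ey ex' ey'; ring.
  - rewrite Normc.normcM sinD.
    transitivity (complex.Re x * complex.Im y + complex.Im x * complex.Re y).
      by case: (x) (y) => ? ? [].
    by rewrite ex ey ex' ey'; ring.
  have := pi_gt0 R; move: b1 b2 b3; rewrite !ltr_norml => /andP[? ?] /andP[? ?] /andP[? ?] ?.
  by apply/andP; split; lra.
by [].
Qed.

(** The mean value theorem gives sin t = t cos c with 0 <= c <= t, and cos decreases on [0, pi]. *)
Lemma sin_tan_bounds t : 0 <= t -> t < pi / 2 -> t * cos t <= sin t <= t.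
Proof.
rewrite le_eqVlt => /orP[/eqP <-|t0 tpi]; first by rewrite mul0r sin0 lexx.
have [|c] := @MVT_segment R sin cos 0 t (ltW t0).
  by apply: derivable_within_continuous => u _; exact: ex_derive.
rewrite in_itv/= => /andP[c0 ct]; rewrite sin0 !subr0 => ->.
apply/andP; split; last by rewrite ler_piMl ?cos_le1 ?ltW.
rewrite mulrC ler_pM2r// leNgt; apply/negP.
by rewrite ltr_cos ?in_itv/= ?c0 ?(ltW t0)//=; lra.
Qed.

(** With a, b, n, t the real part, imaginary part, modulus and argument, sin t <= t <= tan t reads
    b/n <= t <= b/a when t >= 0. *)
Lemma carg_approx x : 0 < complex.Re x ->
  `|carg x - complex.Im x| <= `|complex.Im x| *
    (`|(Normc.normc x)^-1 - 1| + `|(complex.Re x)^-1 - 1|).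
Proof.
move=> Rx; have x0 := Re_gt0_neq0 Rx; have nx := normc_gt0 x0.
have [ex ey] := carg_polar x0; have := carg_bound Rx.
move: Rx ex ey; move: (complex.Re x) (complex.Im x) (Normc.normc x) (carg x) nx.
move=> a b n t n0 a0 ea eb.
(* Conjugation, (t, b) to (-t, -b), reduces to a nonnegative angle. *)
wlog t0 : t b ea eb / 0 <= t.
  move=> H tp; have [t0|t0] := leP 0 t; first exact: H.
  have := H (- t) (- b); rewrite cosN sinN mulrN eb !normrN.
  have -> : - t - - (n * sin t) = - (t - n * sin t) by ring.
  by rewrite normrN; apply => //; lra.
rewrite (ger0_norm t0) => tp.
have /andP[s1 s2] := sin_tan_bounds t0 tp.
have b0 : 0 <= b by rewrite eb mulr_ge0 ?(ltW n0)// sin_ge0_pi// t0/=; have := pi_gt0 R; lra.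
have h1 : b / n <= t by rewrite eb mulrAC mulfV ?gt_eqF// mul1r.
have h2 : t <= b / a.
  rewrite ler_pdivlMr// ea eb mulrCA ler_pM2l//.
rewrite (ger0_norm b0) ler_norml; apply/andP; split.
  have : b * (n^-1 - 1) >= b * - `|n^-1 - 1|.
    by rewrite ler_wpM2l// lerNl -normrN ler_norm.
  have : 0 <= b * `|a^-1 - 1| by rewrite mulr_ge0.
  by move=> ? ?; lra.
have : b * (a^-1 - 1) <= b * `|a^-1 - 1| by rewrite ler_wpM2l// ler_norm.
have : 0 <= b * `|n^-1 - 1| by rewrite mulr_ge0.
by move=> ? ?; lra.
Qed.

Lemma Re_le_normc x : `|complex.Re x| <= Normc.normc x.
Proof.
by case: x => a b /=; rewrite -sqrtr_sqr ler_wsqrtr// lerDl sqr_ge0.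
Qed.

Lemma Im_le_normc x : `|complex.Im x| <= Normc.normc x.
Proof.
by case: x => a b /=; rewrite -sqrtr_sqr ler_wsqrtr// lerDr sqr_ge0.
Qed.

Lemma normc_le_ReIm x : Normc.normc x <= `|complex.Re x| + `|complex.Im x|.
Proof.
rewrite -ler_sqr ?nnegrE ?addr_ge0 ?normc_nneg// normcE sqrrD.
rewrite !real_normK ?num_real//.
have : 0 <= `|complex.Re x| * `|complex.Im x| by rewrite mulr_ge0.
by lra.
Qed.

(** With q = |1 + s|^2 = 1 + 2 Re s + |s|^2, ln|1 + s| = (ln q) / 2, and ln q lies between 1 - 1/q
    and q - 1, both equal to 2 Re s up to a multiple of |s|^2. *)
Lemma ln_normc_approx (s : cplx R) : Normc.normc s <= 2^-1 ->
  `|ln (Normc.normc (1 + s)) - complex.Re s| <= 8 * Normc.normc s ^+ 2.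
Proof.
move=> s2.
have a2 := Re_le_normc s.
have e : Normc.normc (1 + s) ^+ 2 = 1 + 2 * complex.Re s + Normc.normc s ^+ 2.
  by rewrite !normcE; case: (s) => a b /=; ring.
have n0 : 0 < Normc.normc (1 + s).
  apply: normc_gt0; apply: Re_gt0_neq0.
  have -> : complex.Re (1 + s) = 1 + complex.Re s by case: (s).
  by have := ler_norm (- complex.Re s); rewrite normrN; lra.
have a2' : complex.Re s ^+ 2 <= Normc.normc s ^+ 2 by rewrite normcE lerDl sqr_ge0.
move: e n0 s2 (normc_nneg s) a2 a2'.
move: (Normc.normc (1 + s)) (Normc.normc s) (complex.Re s) => n r a e n0 r2 r0 a2 a2'.
have q0 : 0 < n ^+ 2 by rewrite exprn_gt0.
have l2 : ln n = ln (n ^+ 2) / 2 by rewrite lnXn// -mulr_natr; field.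
have up : ln (n ^+ 2) <= n ^+ 2 - 1.
  by have := @le_ln1Dx R (n ^+ 2 - 1); rewrite (addrC 1) subrK; apply; lra.
have lo : - ln (n ^+ 2) <= (n ^+ 2)^-1 - 1.
  rewrite -lnV ?posrE//.
  have := @le_ln1Dx R ((n ^+ 2)^-1 - 1); rewrite (addrC 1) subrK; apply.
  have : 0 < (n ^+ 2)^-1 by rewrite invr_gt0.
  by lra.
move: a2; rewrite ler_norml => /andP[a_1 a_2].
(* The product (1/2 - r)(3/2 - r) >= 0 is a form of (1 - r)^2 >= 1/4. *)
have q4 : 1 / 4 <= n ^+ 2.
  have : 0 <= (1 / 2 - r) * (3 / 2 - r) by rewrite mulr_ge0//; lra.
  rewrite e; lra.
rewrite l2 ler_norml; apply/andP; split; last first.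
  by have := sqr_ge0 r; lra.
suff : (n ^+ 2)^-1 - 1 <= 16 * r ^+ 2 - 2 * a by lra.
have -> : (n ^+ 2)^-1 - 1 = (1 - n ^+ 2) / n ^+ 2 by field; rewrite gt_eqF.
rewrite ler_pdivrMr//.
(* Expanded, the claim is 4 a^2 + 2 a r^2 <= 16 r^2 n^2 + r^2; it follows from a^2 <= r^2, n^2 >=
   1/4 and a <= 1/2. *)
have h1 : 0 <= r ^+ 2 * (n ^+ 2 - 1 / 4) by rewrite mulr_ge0 ?sqr_ge0//; lra.
have h2 : 0 <= r ^+ 2 * (1 / 2 - a) by rewrite mulr_ge0 ?sqr_ge0//; lra.
have : 2 * a * n ^+ 2 = 2 * a + 4 * a ^+ 2 + 2 * a * r ^+ 2 by rewrite e; ring.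
by lra.
Qed.

(** The modulus and the real part of 1 + s are at least 1/2 and within |s| of 1, so each reciprocal
    in [carg_approx] is within 2 |s| of 1. *)
Lemma carg_approx1 (s : cplx R) : Normc.normc s <= 2^-1 ->
  `|carg (1 + s) - complex.Im s| <= 4 * Normc.normc s ^+ 2.
Proof.
move=> s2.
have a2 := Re_le_normc s; have b2 := Im_le_normc s.
have eR : complex.Re (1 + s) = 1 + complex.Re s by case: (s).
have eI : complex.Im (1 + s) = complex.Im s by case: (s) => ? ? /=; rewrite add0r.
move: (a2); rewrite ler_norml => /andP[a_1 a_2].
have R2 : 2^-1 <= complex.Re (1 + s) by rewrite eR; lra.
have R0 : 0 < complex.Re (1 + s) by lra.
have := carg_approx R0; rewrite eI => /le_trans; apply.
have n2 : 2^-1 <= Normc.normc (1 + s).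
  by apply: le_trans R2 _; apply: le_trans (Re_le_normc _); exact: ler_norm.
have inv2 (t : R) : 2^-1 <= t -> `|t - 1| <= Normc.normc s -> `|t^-1 - 1| <= 2 * Normc.normc s.
  move=> t2 h; have t0 : 0 < t by lra.
  have -> : t^-1 - 1 = - (t - 1) / t by field; rewrite gt_eqF.
  rewrite normrM normrN normfV (gtr0_norm t0) ler_pdivrMr//.
  apply: le_trans h _; have : 0 <= Normc.normc s * (2 * t - 1).
    by rewrite mulr_ge0 ?normc_nneg//; lra.
  by lra.
have n1 : `|Normc.normc (1 + s) - 1| <= Normc.normc s.
  have h1 := @le_normcD R 1 s; have h2 := @le_normcD R (1 + s) (- s).
  rewrite ler_norml; move: h1 h2; rewrite addrK normcN Normc.normc1 => h1 h2.
  by apply/andP; split; lra.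
have i1 := inv2 _ n2 n1.
have i2 : `|(complex.Re (1 + s))^-1 - 1| <= 2 * Normc.normc s.
  by apply: inv2 => //; rewrite eR addrAC subrr add0r.
have -> : 4 * Normc.normc s ^+ 2 = Normc.normc s * (2 * Normc.normc s + 2 * Normc.normc s) by ring.
by rewrite ler_pM// ?addr_ge0// lerD.
Qed.

(** The constant 12 is 8 from the real part plus 4 from the imaginary part. *)
Lemma clog1D_approx (s : cplx R) : Normc.normc s <= 2^-1 ->
  Normc.normc (clog (1 + s) - s) <= 12 * Normc.normc s ^+ 2.
Proof.
move=> s2; apply: le_trans (normc_le_ReIm _) _.
have := carg_approx1 s2; have := ln_normc_approx s2.
have -> : complex.Re (clog (1 + s) - s) = ln (Normc.normc (1 + s)) - complex.Re s.
  by rewrite /clog; case: (s).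
have -> : complex.Im (clog (1 + s) - s) = carg (1 + s) - complex.Im s.
  by rewrite /clog; case: (s).
by lra.
Qed.

Lemma normcEE (x : cplx R) : `|x| = (Normc.normc x)%:C.
Proof. by case: x. Qed.

(** By [clogM], clog(p + h) - clog(p) = clog(1 + h/p) for small h, and [clog1D_approx] makes this
    h/p up to a quadratic remainder. *)
Lemma is_derive_clog (p : cplx R) : 0 < complex.Re p ->
  is_derive p 1 (@clog R) p^-1.
Proof.
move=> Rp; have p0 := Re_gt0_neq0 Rp.
have c : h^-1 *: ((@clog R \o shift p) (h *: 1) - clog p) @[h --> (0 : cplx R)^'] --> p^-1.
  apply/cvgrPdist_le => e e0.
  near=> h.
  have h0 : h != 0 by near: h; exact: nbhs_dnbhs_neq.
  have -> : (@clog R \o shift p) (h *: 1) = clog (p * (1 + h / p)).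
    by rewrite /= [h *: 1]mulr1 mulrDr mulr1 mulrCA mulfV// mulr1 addrC.
  have p_gt0 : 0 < `|p| by rewrite normr_gt0.
  (* Three smallness conditions: [hp] gives |h/p| <= 1/2, [hRp] keeps p + h in the right half-plane,
     and [hep] brings the remainder 12 |h/p|^2 below e |h|. *)
  have hp : `|h| <= `|p| / 2.
    by near: h; apply: dnbhs0_le; rewrite divr_gt0// normr_gt0.
  have hRp : `|h| < (complex.Re p)%:C.
    by near: h; apply: dnbhs0_lt; rewrite (@ltcR R 0).
  have hep : `|h| <= e * `|p| ^+ 2 / 12.
    by near: h; apply: dnbhs0_le; rewrite divr_gt0// mulr_gt0// exprn_gt0// normr_gt0.
  have s2 : Normc.normc (h / p) <= 2^-1.
    rewrite -(@lecR R) -normcEE normrM normfV ler_pdivrMr// mulrC.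
    by rewrite fmorphV rmorph_nat.
  have Re1s : 0 < complex.Re (1 + h / p).
    have := Re_le_normc (h / p); rewrite ler_norml => /andP[? _].
    have -> : complex.Re (1 + h / p) = 1 + complex.Re (h / p) by case: (h / p).
    by lra.
  have e1 : p * (1 + h / p) = p + h by rewrite mulrDr mulr1 mulrCA mulfV// mulr1.
  rewrite clogM//; last first.
    rewrite e1; have := Re_le_normc h; rewrite ler_norml => /andP[? _].
    move: hRp; rewrite normcEE (@ltcR R).
    have -> : complex.Re (p + h) = complex.Re p + complex.Re h by case: (p) (h) => ? ? [].
    by lra.
  have -> : p^-1 - h^-1 *: (clog p + clog (1 + h / p) - clog p) =
      - (h^-1 * (clog (1 + h / p) - h / p)).
    by rewrite [_ *: _]/(_ * _) (addrC (clog p)) addrK mulrBr mulKf// opprB.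
  rewrite normrN normrM normfV ler_pdivrMl ?normr_gt0//.
  have := clog1D_approx s2; rewrite -(@lecR R) -normcEE => /le_trans; apply.
  have -> : (12 * Normc.normc (h / p) ^+ 2)%:C = 12 * (`|h| / `|p|) ^+ 2.
    have -> : `|h| / `|p| = (Normc.normc (h / p))%:C by rewrite -normcEE normrM normfV.
    by rewrite rmorphM rmorphXn rmorph_nat.
  rewrite expr_div_n mulrA ler_pdivrMr ?exprn_gt0// -mulrA expr2 mulrCA ler_pM2l ?normr_gt0//.
  by rewrite mulrC -ler_pdivlMr.
split; first by apply/cvg_ex; exists p^-1.
exact: cvg_lim.
Unshelve. all: by end_near.
Qed.

End complex_log.

(** * The kernel on the unit disc *)

Section complex_kernel.
Variable R : realType.
Implicit Types x y : cplx R.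

(** The function L in the disc: [dirichlet_kernel w z] unfolds to [cker (dotmx z w)]. *)
Definition cker x : cplx R := 1 + clog (1 / (1 - x)).

Definition cker_dlog x : cplx R := ((1 - x) * cker x)^-1.

Lemma normc_lt1 x : (`|x| < 1) = (Normc.normc x < 1).
Proof. by rewrite normcEE -[RHS](@ltcR R). Qed.

Lemma Re_subr1_gt0 x : `|x| < 1 -> 0 < complex.Re (1 - x).
Proof.
rewrite normc_lt1 => x1.
have -> : complex.Re (1 - x) = 1 - complex.Re x by case: (x).
rewrite subr_gt0; apply: le_lt_trans x1.
exact: le_trans (ler_norm _) (Re_le_normc x).
Qed.

Lemma Re_inv_gt0 x : 0 < complex.Re x -> 0 < complex.Re x^-1.
Proof.
case: x => a b /= a0; rewrite divr_gt0// ltr_pwDl ?sqr_ge0//.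
by rewrite exprn_gt0.
Qed.

Lemma cker0 : cker 0 = 1.
Proof.
rewrite /cker subr0 divr1 /clog /carg Normc.normc1 ln1 divr1 /= lexx acos1.
exact: addr0.
Qed.

Lemma is_derive_cker x : `|x| < 1 -> is_derive x 1 cker (1 - x)^-1.
Proof.
move=> x1; have Rx := Re_subr1_gt0 x1; have n0 := Re_gt0_neq0 Rx.
have dc : is_derive (1 / (1 - x)) 1 (@clog R) (1 - x).
  rewrite div1r -[X in is_derive _ _ _ X]invrK.
  by apply: is_derive_clog; exact: Re_inv_gt0.
have di : is_derive x 1 (fun t : cplx R => 1 / (1 - t)) ((1 - x) ^- 2).
  have dB : is_derive x 1 (fun t : cplx R => 1 - t) (-1).
    by apply: is_derive_eq; rewrite sub0r.
  have n0' : (fun t : cplx R => 1 - t) x != 0 by [].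
  have -> : (fun t : cplx R => 1 / (1 - t)) = (fun t => (1 - t)^-1).
    by apply/funext => t; rewrite div1r.
  have [dB1 dB2] := dB.
  apply: DeriveDef; first exact: (@derivableV (cplx R) (cplx R) (fun t : cplx R => 1 - t) x 1 n0' dB1).
  rewrite (@deriveV (cplx R) (cplx R) (fun t : cplx R => 1 - t) x 1 n0' dB1) dB2.
  by rewrite scaleNr scalerN opprK [_ *: _]mulr1.
have d := @is_derive1_chain _ (@clog R) (fun t : cplx R => 1 / (1 - t)) _ _ _ dc di.
have -> : cker = (cst 1 + (@clog R \o (fun t : cplx R => 1 / (1 - t)))) by [].
apply: is_derive_eq.
by rewrite add0r; field.
Qed.

Lemma is_derive_mulr_line x :
  is_derive (0 : cplx R) 1 (fun t : cplx R => t * x) x.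
Proof.
have d := @is_deriveM (cplx R) (cplx R) id (cst x) 0 1 _ _
  (is_derive_id _ _) (is_derive_cst _ _ _).
by apply: (is_derive_eq d); rewrite scaler0 add0r [_ *: _]mulr1.
Qed.

Lemma is_derive_cker_line x :
  is_derive (0 : cplx R) 1 (fun t : cplx R => cker (t * x)) x.
Proof.
have d2 : is_derive ((fun t : cplx R => t * x) 0) 1 cker 1.
  have := @is_derive_cker 0; rewrite normr0 ltr01 subr0 invr1 mul0r; exact.
have := @is_derive1_chain _ cker (fun t : cplx R => t * x) _ _ _ d2
  (is_derive_mulr_line x).
by rewrite mul1r.
Qed.

(** The real part of L(x) is 1 - ln|1 - x|, positive because |1 - x| < 2 and ln n <= n - 1. *)
Lemma cker_neq0 x : `|x| < 1 -> cker x != 0.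
Proof.
move=> x1; have Rx := Re_subr1_gt0 x1; have n0 := Re_gt0_neq0 Rx.
apply: Re_gt0_neq0.
have -> : complex.Re (cker x) = 1 - ln (Normc.normc (1 - x)).
  by rewrite /cker /clog /= div1r Normc.normcV lnV ?posrE ?normc_gt0.
rewrite subr_gt0.
have n2 : Normc.normc (1 - x) < 2.
  apply: le_lt_trans (le_normcD _ _) _; rewrite normcN Normc.normc1.
  by move: x1; rewrite normc_lt1 => ?; lra.
move: (Normc.normc (1 - x)) n2 (normc_gt0 n0) => n n2 n_gt0.
have : ln (1 + (n - 1)) <= n - 1 by apply: le_ln1Dx; lra.
by rewrite (addrC 1) subrK; lra.
Qed.

Lemma carg_real (r : R) : 0 < r -> carg r%:C = 0.
Proof.
move=> r0; rewrite /carg /= lexx expr0n addr0 sqrtr_sqr gtr0_norm// divff ?gt_eqF//.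
exact: acos1.
Qed.

Lemma cker_real (r : R) : -1 < r -> r < 1 -> cker r%:C = (rker r)%:C.
Proof.
move=> r0 r1; rewrite /cker /rker.
have -> : 1 / (1 - r%:C) = ((1 - r)^-1)%:C by rewrite div1r fmorphV rmorphB rmorph1.
have i0 : 0 < (1 - r)^-1 by rewrite invr_gt0; lra.
rewrite /clog carg_real// rmorphB rmorph1; congr (_ + _).
rewrite /= expr0n addr0 sqrtr_sqr gtr0_norm// lnV ?posrE//; last lra.
by apply/eqP; rewrite eq_complex /= oppr0 !eqxx.
Qed.

Lemma cker_dlog_real (r : R) : -1 < r -> r < 1 -> cker_dlog r%:C = (rker_dlog r)%:C.
Proof.
move=> r0 r1; rewrite /cker_dlog /rker_dlog cker_real//.
rewrite [RHS]fmorphV; congr (_ ^-1).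
rewrite [RHS]rmorphM; congr (_ * _).
by rewrite [RHS]rmorphB rmorph1.
Qed.

Lemma clog_conj x : 0 < complex.Re x -> clog x^* = (clog x)^*.
Proof.
move=> Rx; have x0 := Re_gt0_neq0 Rx.
have Rc : complex.Re x^* = complex.Re x by case: (x).
have Ic : complex.Im x^* = - complex.Im x by case: (x).
have Nc : Normc.normc x^* = Normc.normc x by case: (x) => a b /=; rewrite sqrrN.
have [e1 e2] := carg_polar x0.
have Rx' : 0 < complex.Re x^* by rewrite Rc.
have -> : clog x^* = (ln (Normc.normc x) -i* carg x)%C.
  rewrite /clog Nc; congr (_ +i* _)%C; apply: carg_uniq.
  - exact: Re_gt0_neq0.
  - by rewrite Rc Nc cosN.
  - by rewrite Ic Nc sinN mulrN e2.
  - have := carg_bound Rx; have := carg_bound Rx'; rewrite !ltr_norml.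
    by have := pi_gt0 R => ? /andP[? ?] /andP[? ?]; apply/andP; split; lra.
by [].
Qed.

Lemma cker_conj x : `|x| < 1 -> cker x^* = (cker x)^*.
Proof.
move=> x1; have Rx := Re_subr1_gt0 x1.
have e : clog (1 / (1 - x^*)) = (clog (1 / (1 - x)))^*.
  rewrite -clog_conj; last by rewrite div1r Re_inv_gt0.
  by congr clog; rewrite [RHS]fmorph_div rmorphB !rmorph1.
by rewrite /cker e [RHS]rmorphD rmorph1.
Qed.

Lemma cker_dlog_conj x : `|x| < 1 -> cker_dlog x^* = (cker_dlog x)^*.
Proof.
by move=> x1; rewrite /cker_dlog cker_conj// [RHS]fmorphV rmorphM rmorphB rmorph1.
Qed.

Lemma cker_dlog0 : cker_dlog 0 = 1.
Proof. by rewrite /cker_dlog cker0 subr0 mulr1 invr1. Qed.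

End complex_kernel.

(** * The inner product and the unit ball *)

Section inner_product.
Variables (C : numClosedFieldType) (n : nat).
Implicit Types u v w z a : 'rV[C]_n.

Lemma dotmxDl u v w : dotmx (u + v) w = dotmx u w + dotmx v w.
Proof. exact: linearDl. Qed.

Lemma dotmxDr u v w : dotmx w (u + v) = dotmx w u + dotmx w v.
Proof. exact: linearDr. Qed.

Lemma dotmxZl (c : C) u w : dotmx (c *: u) w = c * dotmx u w.
Proof. exact: linearZl_LR. Qed.

Lemma dotmxZr (c : C) u w : dotmx u (c *: w) = c^* * dotmx u w.
Proof. exact: linearZr_LR. Qed.

Lemma dotmxC u v : dotmx v u = (dotmx u v)^*.
Proof. by rewrite (@hermC _ _ _ _ (@dotmx C n)) expr0 mul1r. Qed.

Lemma dotmx_ge0 u : 0 <= dotmx u u.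
Proof. exact: dnorm_ge0. Qed.

Lemma dotmx0l u : dotmx 0 u = 0.
Proof. exact: linear0l. Qed.

Lemma dotmx0r u : dotmx u 0 = 0.
Proof. exact: linear0r. Qed.

Lemma dotmx_inj u v : (forall z, dotmx z u = dotmx z v) -> u = v.
Proof.
move=> h.
have e : dotmx (u - v) (u - v) = dotmx (u - v) u - dotmx (u - v) v.
  exact: linearBr.
move/eqP: e; rewrite h subrr (dnorm_eq0 (@dotmx C n)) subr_eq0.
by move/eqP.
Qed.

Lemma dotmx_sum u v : dotmx u v = \sum_i u 0 i * (v 0 i)^*.
Proof. by rewrite dotmxE !mxE; apply: eq_bigr => i _; rewrite !mxE. Qed.

(** Complex polarization: if the quadratic form vanishes, its values at u + v and i u + v force
    every <uM,v> to vanish. *)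
Lemma exists_form_neq0 (M : 'M[C]_n) : M != 0 ->
  exists v : 'rV[C]_n, dotmx (v *m M) v != 0.
Proof.
move=> M0; apply: contrapT => /forallNP q0.
have {}q0 v : dotmx (v *m M) v = 0 by apply/eqP/negPn/negP; exact: q0.
case/eqP: M0; apply/row_matrixP => i; rewrite row0 rowE.
apply: dotmx_inj => v; rewrite dotmx0r; move: (delta_mx _ _) => u.
have h1 := q0 (u + v); have h2 := q0 ('i *: u + v).
move: h1 h2; rewrite !mulmxDl -!scalemxAl !dotmxDl !dotmxDr !dotmxZl !dotmxZr !q0.
rewrite conjCi !mulr0 !addr0 !add0r => h1 h2.
have e : dotmx (v *m M) u = - dotmx (u *m M) v by apply/eqP; rewrite -addr_eq0 addrC h1.
move: h2; rewrite e mulrN mulNr opprK -mulrDr => /eqP.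
rewrite mulf_eq0 (negPf (neq0Ci _)) /= -mulr2n mulrn_eq0 /= => /eqP h.
by rewrite dotmxC h conjC0.
Qed.

(** Let q(v) = <vM,v> and q(v0) != 0. If neither a nor v0 will do, then q(a) = 0 and <v0,a> = 0, and
    q(v0 + a) + q(v0 - a) = 2 q(v0) shows that v0 + a or v0 - a does. *)
Lemma exists_positive_direction (M : 'M[C]_n) a : a != 0 -> M != 0 ->
  (forall u v, dotmx (u *m M) v = dotmx u (v *m M)) ->
  exists2 v, 0 < dotmx v a & dotmx (v *m M) v != 0.
Proof.
move=> a0 /exists_form_neq0[v0 qv0] hM.
have [v va qv] : exists2 v, dotmx v a != 0 & dotmx (v *m M) v != 0.
  have qaa : dotmx a a != 0 by rewrite (dnorm_eq0 (@dotmx C n)).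
  have [qa|qa] := eqVneq (dotmx (a *m M) a) 0; last by exists a.
  have [va|va] := eqVneq (dotmx v0 a) 0; last by exists v0.
  have [qp|qp] := eqVneq (dotmx ((v0 + a) *m M) (v0 + a)) 0; last first.
    by exists (v0 + a) => //; rewrite dotmxDl va add0r.
  exists (v0 - a); rewrite -scaleN1r.
    by rewrite dotmxDl dotmxZl va add0r mulN1r oppr_eq0.
  apply/negP => /eqP; move: qp.
  rewrite !mulmxDl -!scalemxAl !dotmxDl !dotmxDr !dotmxZl !dotmxZr qa rmorphN1.
  move: qv0; set p := dotmx (v0 *m M) v0; set q := dotmx _ a; set r := dotmx _ v0.
  move=> p0 e1 e2; case/eqP: p0.
  have e3 : p + p = 0.
    have -> : p + p = (p + q + (r + 0)) + (p + -1 * q + (-1 * r + -1 * (-1 * 0))) by ring.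
    by rewrite e1 e2 addr0.
  by move/eqP: e3; rewrite -mulr2n mulrn_eq0 => /eqP.
(* This scaling makes the product with a equal to |<v,a>|^2 and multiplies the form by a positive
   factor. *)
exists ((dotmx v a)^* *: v); first by rewrite dotmxZl mulrC mul_conjC_gt0.
by rewrite -scalemxAl dotmxZl dotmxZr conjCK mulrA !mulf_neq0// conjC_eq0.
Qed.

Lemma norm_dotmx_lt1 u v : dotmx u u < 1 -> dotmx v v < 1 -> `|dotmx u v| < 1.
Proof.
move=> u1 v1.
have cs : `|dotmx u v| ^+ 2 <= dotmx u u * dotmx v v by exact: CauchySchwarz.
rewrite -(@expr_lt1 _ 2)//; apply: le_lt_trans cs _.
by rewrite mulr_ilt1// dotmx_ge0.
Qed.

Lemma dotmx_adjoint (M : 'M[C]_n) u v :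
  dotmx (u *m M) v = dotmx u (v *m map_mx Num.conj M^T).
Proof.
rewrite !dotmxE trmx_mul map_mxM -mulmxA; congr ((_ *m (_ *m _)) _ _).
by apply/matrixP => i j; rewrite !mxE; exact: esym (conjCK _).
Qed.

(** Stated for [M^T] because [jacobian_matrix] is the transpose of [jacobian], which acts on row
    vectors. *)
Lemma hermsymmx_dotmxP (M : 'M[C]_n) : M^T \is hermsymmx <->
  (forall u v, dotmx (u *m M) v = dotmx u (v *m M)).
Proof.
split => [/is_hermitianmxP|hM].
  rewrite expr0 scale1r trmxK => eM u v.
  by rewrite dotmx_adjoint eM -map_mx_comp map_mx_id// => x; exact: conjCK.
have eM : M = map_mx Num.conj M^T.
  apply/row_matrixP => i; rewrite !rowE; apply: dotmx_inj => z.
  by rewrite -hM dotmx_adjoint.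
by apply/is_hermitianmxP; rewrite expr0 scale1r trmxK {1}eM map_trmx trmxK.
Qed.

End inner_product.

(** * The unit ball and derivatives along complex lines through the origin *)

Section ball.
Variables (R : realType) (N : nat).
Implicit Types u v w z : 'rV[cplx R]_N.

Lemma unit_ball0 : unit_ball (0 : 'rV[cplx R]_N).
Proof. by rewrite /unit_ball /= dotmx0l ltr01. Qed.

Lemma unit_ballZ a z : `|a| ^+ 2 * dotmx z z < 1 -> unit_ball (a *: z).
Proof. by rewrite /unit_ball /= dotmxZl dotmxZr mulrA normCK. Qed.

Lemma near0_unit_ballZ z :
  \forall t \near (0 : cplx R), unit_ball (t *: z).
Proof.
have q0 : 0 < 1 + dotmx z z by rewrite ltr_pwDl// dotmx_ge0.
(* If |t| < 1 / (1 + |z|^2), then |t| <= 1 and |t|^2 |z|^2 <= |t| |z|^2 < 1. *)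
have r0 : 0 < (1 + dotmx z z)^-1 by rewrite invr_gt0.
near=> t.
apply: unit_ballZ.
have t1 : `|t| < (1 + dotmx z z)^-1.
  by near: t; exact: (@nbhs0_lt _ (cplx R) _ r0).
have t2 : `|t| <= 1.
  apply: le_trans (ltW t1) _; rewrite invf_le1// lerDl dotmx_ge0//.
have : `|t| ^+ 2 * dotmx z z <= `|t| * dotmx z z.
  by rewrite ler_wpM2r ?dotmx_ge0// expr2 ler_piMl.
move=> /le_lt_trans; apply.
have : `|t| * (1 + dotmx z z) < 1 by rewrite -ltr_pdivlMr// div1r.
by apply: le_lt_trans; rewrite ler_wpM2l// lerDr.
Unshelve. all: by end_near. Qed.

Lemma differentiable_dotmx w (x : 'rV[cplx R]_N) :
  differentiable (fun u : 'rV[cplx R]_N => dotmx u w) x.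
Proof.
have -> : (fun u : 'rV[cplx R]_N => dotmx u w) =
    \sum_(i < N) (fun u : 'rV[cplx R]_N => u 0 i * (w 0 i)^*).
  by apply/funext => u; rewrite fct_sumE dotmx_sum.
apply: differentiable_sum => i.
have := @differentiableZl _ _ _ _ ((w 0 i)^* : cplx R) _ (@differentiable_coord (cplx R) 1 N x 0 i).
exact.
Qed.

Lemma diff_dotmx w (x v : 'rV[cplx R]_N) :
  'd (fun u : 'rV[cplx R]_N => dotmx u w) x v = dotmx v w.
Proof.
rewrite -deriveE; last exact: differentiable_dotmx.
apply: cvg_lim => //; apply: cvg_near_cst; near=> h.
have h0 : h != 0 by near: h; exact: nbhs_dnbhs_neq.
rewrite /= dotmxDl dotmxZl addrK [_ *: _]mulKf//.
Unshelve. all: by end_near. Qed.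

Lemma is_derive_dotmx_line (phi : 'rV[cplx R]_N -> 'rV[cplx R]_N) z w :
  differentiable phi 0 ->
  is_derive (0 : cplx R) 1 (fun t : cplx R => dotmx (phi (t *: z)) w)
    (dotmx (z *m jacobian phi 0) w).
Proof.
move=> dphi.
have ds : differentiable (fun t : cplx R => t *: z) (0 : cplx R).
  by have [] := @is_diff_scalel _ _ (0 : cplx R) z.
have es : 'd (fun t : cplx R => t *: z) (0 : cplx R) 1 = z.
  have [_ ->] := @is_diff_scalel _ _ (0 : cplx R) z.
  exact: scale1r.
have dphi' : differentiable phi ((fun t : cplx R => t *: z) 0) by rewrite scale0r.
have d1 := differentiable_comp ds dphi'.
have d2 := differentiable_comp d1 (differentiable_dotmx w _).
apply: DeriveDef; first exact/derivable1_diffP.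
have -> : (fun t : cplx R => dotmx (phi (t *: z)) w) =
  (fun u : 'rV[cplx R]_N => dotmx u w) \o (phi \o (fun t : cplx R => t *: z)) by [].
rewrite (deriveE _ d2) (diff_comp d1 (differentiable_dotmx w _)) /=.
rewrite diff_dotmx (diff_comp ds dphi') /= es scale0r.
by rewrite /jacobian mul_rV_lin1.
Qed.

End ball.

(** * Hermitian weighted composition operators *)

Section kernel_identity.
Variables (R : realType) (N : nat) (D : set ('rV[cplx R]_N -> cplx R)).
Variable ip : ('rV[cplx R]_N -> cplx R) -> ('rV[cplx R]_N -> cplx R) -> cplx R.
Hypothesis hD : dirichlet_space D ip.
Variables (phi : 'rV[cplx R]_N -> 'rV[cplx R]_N) (psi : 'rV[cplx R]_N -> cplx R).
Hypothesis phiB : forall z, unit_ball z -> unit_ball (phi z).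
Hypothesis hW : bounded_operator D ip (weighted_composition psi phi).

Local Notation T := (weighted_composition psi phi).
Local Notation K := (@dirichlet_kernel R N).
Let hH := ds_hilbert hD.

Let ip_conj f g : D f -> D g -> ip g f = (ip f g)^*.
Proof. exact: hfs_ip_conj hH _ _. Qed.

(** Agreement on the ball is not equality of total functions, but g - h has norm zero, and
    Cauchy-Schwarz gives <f, g - h> = 0. *)
Let ip_ext f g h : D f -> D g -> D h -> (forall z, unit_ball z -> g z = h z) ->
  ip f g = ip f h.
Proof.
move=> Df Dg Dh gh.
pose d := fun z => (-1) * h z + g z.
have Dd : D d by apply: (hfs_linear hH).
have d0 : nsq ip d = 0.
  have /(hfs_ip_eq0 hH Dd) e : forall z, unit_ball z -> d z = 0.
    by move=> z Bz; rewrite /d gh// mulN1r addNr.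
  by rewrite /nsq e.
have := cauchy_schwarz hH Df Dd; rewrite d0 mulr0 => le0.
have : ip f d = 0.
  apply: Normc.eq0_normc; apply/eqP; rewrite -sqrf_eq0 eq_le le0 sqr_ge0//.
rewrite /d (hfs_ip_linearr hH)// rmorphN1 mulN1r addrC => /eqP.
by rewrite subr_eq0 => /eqP.
Qed.

(** The two sides of the identity are <T K_w, K_z> and <K_w, T K_z>, with T the operator. For the
    converse, T is first moved across products with kernel functions, then across all products by
    Riesz. *)
Lemma hermitian_kernelP : hermitian_operator D ip T <->
  (forall z w, unit_ball z -> unit_ball w ->
    psi z * cker (dotmx (phi z) w) = (psi w)^* * cker (dotmx z (phi w))).
Proof.
have [TD [M TM]] := hW.
have DK w : unit_ball w -> D (K w) by exact: ds_kernel hD _.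
have rep f w : D f -> unit_ball w -> f w = ip f (K w) by move=> *; apply: (ds_reproducing hD).
split => [hT z w Bz Bw|hK f g Df Dg].
  have DTz := TD _ (DK _ Bz); have DTw := TD _ (DK _ Bw).
  have -> : psi z * cker (dotmx (phi z) w) = T (K w) z by [].
  rewrite (rep _ _ DTw Bz) (hT _ _ (DK _ Bw) (DK _ Bz)).
  rewrite (ip_conj DTz (DK _ Bw)) -(rep _ _ DTz Bw).
  have -> : cker (dotmx z (phi w)) = (K z (phi w))^*.
    rewrite (rep _ _ (DK _ Bz) (phiB Bw)) -(ip_conj (DK _ Bz) (DK _ (phiB Bw))).
    by rewrite -(rep _ _ (DK _ (phiB Bw)) Bz).
  exact: rmorphM.
(* The identity says that T K_w = conj(psi(w)) K_phi(w) on the ball. The multiple is written with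
   [+ 0] to fit the shape of [hfs_linear]. *)
have adj f' w : D f' -> unit_ball w -> ip (T f') (K w) = ip f' (T (K w)).
  move=> Df' Bw; rewrite -rep//; last exact: TD.
  have DK' : D (fun z => (psi w)^* * K (phi w) z + 0).
    apply: (hfs_linear hH) (hfs_zero hH); exact: DK (phiB Bw).
  rewrite (@ip_ext _ _ (fun z => (psi w)^* * K (phi w) z + 0) Df' (TD _ (DK _ Bw)) DK').
    rewrite (hfs_ip_linearr hH) ?conjCK//; last 2 first.
    - exact: DK (phiB Bw).
    - exact: hfs_zero hH.
    rewrite -(rep _ _ Df' (phiB Bw)).
    have D0 := hfs_zero hH.
    rewrite (ip_conj D0 Df') (ip0l hH (fun=> erefl) Df') rmorph0 addr0 //.
  by move=> z Bz; rewrite addr0; exact: hK.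
(* Here h is the adjoint of T applied to g; boundedness of T makes the functional bounded. *)
have [| |h Dh hh] := @riesz_representation _ _ _ _ _ hH
  (fun f => ip (T f) g) (M * hnorm ip g).
- move=> a f1 f2 D1 D2.
  have -> : T (fun z => a * f1 z + f2 z) = (fun z => a * T f1 z + T f2 z).
    by apply/funext => z; rewrite /weighted_composition; ring.
  by rewrite (hfs_ip_linear hH)//; exact: TD.
- move=> f1 D1; apply: le_trans (normc_ip_le hH (TD _ D1) Dg) _.
  by rewrite mulrAC ler_wpM2r ?hnorm_ge0 ?TM.
rewrite (hh _ Df); apply: ip_ext => //; first exact: TD.
(* On the ball, h(w) = conj <T K_w, g> = <g, T K_w> = <T g, K_w> = (T g)(w). *)
move=> w Bw; rewrite (rep _ _ Dh Bw) (ip_conj (DK _ Bw) Dh) -(hh _ (DK _ Bw)).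
rewrite -(ip_conj (TD _ (DK _ Bw)) Dg) -(adj _ _ Dg Bw).
by rewrite -(rep _ _ (TD _ Dg) Bw).
Qed.

End kernel_identity.

(** Solves the differentiated identity for q = <z,phi(w)>, with p = <z,phi(0)>, s = 1 - <phi(0),w>
    and L = L(<phi(0),w>). *)
Lemma log_derivative_solve (F : fieldType) (L s p q x : F) : L != 0 -> s != 0 ->
  p * L + s^-1 * x = L * q -> q = p + (s * L)^-1 * x.
Proof.
move=> L0 s0 e; apply: (mulfI L0); rewrite -e; field.
by rewrite L0 s0.
Qed.

Lemma linear_solve (F : fieldType) (m p q x : F) : m != 0 ->
  p = q + m^-1 * x -> m * (p - q) = x.
Proof. by move=> m0 ->; field. Qed.

Lemma conjC_affine (C : numClosedFieldType) (p q x : C) :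
  (p + q * x)^* = p^* + q^* * x^*.
Proof. by rewrite rmorphD rmorphM. Qed.

(** * Differentiating the functional equation at the origin *)

Section functional_equation.
Variables (R : realType) (N : nat) (phi : 'rV[cplx R]_N -> 'rV[cplx R]_N).
Hypothesis phiB : forall z, unit_ball z -> unit_ball (phi z).
Hypothesis dphi : differentiable phi 0.
Hypothesis cker_eq : forall z w, unit_ball z -> unit_ball w ->
  cker (dotmx z (phi 0)) * cker (dotmx (phi z) w) =
  cker (dotmx (phi 0) w) * cker (dotmx z (phi w)).

Let B0 : unit_ball (0 : 'rV[cplx R]_N) := @unit_ball0 R N.
Let A := jacobian phi 0.

(** Both sides of [cker_eq] at t z are differentiated at t = 0, with L(0) = L'(0) = 1. The vector z
    is arbitrary, since t z lies in the ball for small t. *)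
Lemma phi_formula z w : unit_ball w ->
  dotmx z (phi w) = dotmx z (phi 0) + cker_dlog (dotmx (phi 0) w) * dotmx (z *m A) w.
Proof.
move=> Bw.
have y1 : `|dotmx (phi 0) w| < 1 by exact: (norm_dotmx_lt1 (phiB B0) Bw).
set y := dotmx (phi 0) w in y1 *.
have L0 := cker_neq0 y1; have s0 := Re_gt0_neq0 (Re_subr1_gt0 y1).
have g1 : is_derive (0 : cplx R) 1
    (fun t : cplx R => cker (dotmx (t *: z) (phi 0)) * cker (dotmx (phi (t *: z)) w))
    (dotmx z (phi 0) * cker y + (1 - y)^-1 * dotmx (z *m A) w).
  have d1 : is_derive (0 : cplx R) 1 (fun t : cplx R => cker (dotmx (t *: z) (phi 0)))
      (dotmx z (phi 0)).
    by under eq_fun do rewrite dotmxZl; exact: is_derive_cker_line.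
  have d2 : is_derive ((fun t : cplx R => dotmx (phi (t *: z)) w) 0) 1 (@cker R) (1 - y)^-1.
    by rewrite scale0r; exact: is_derive_cker.
  have d3 := is_derive_dotmx_line z w dphi.
  have d4 := @is_derive1_chain _ (@cker R) (fun t : cplx R => dotmx (phi (t *: z)) w) _ _ _ d2 d3.
  have d5 := @is_deriveM _ _ _ _ _ _ _ _ d1 d4.
  apply: (is_derive_eq d5).
  rewrite /= !scale0r dotmx0l cker0 scale1r [RHS]addrC -/y.
  by rewrite (mulrC (dotmx z (phi 0))).
have g2 : is_derive (0 : cplx R) 1
    (fun t : cplx R => cker y * cker (dotmx (t *: z) (phi w)))
    (cker y * dotmx z (phi w)).
  under eq_fun do rewrite dotmxZl.
  exact: (@is_deriveZ _ _ _ (fun t : cplx R => cker (t * dotmx z (phi w))) (cker y)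
    _ _ _ (is_derive_cker_line _)).
have g12 : \forall t \near (0 : cplx R),
    cker (dotmx (t *: z) (phi 0)) * cker (dotmx (phi (t *: z)) w) =
    cker y * cker (dotmx (t *: z) (phi w)).
  by near=> t; apply: (cker_eq _ Bw); near: t; exact: near0_unit_ballZ.
have := near_eq_is_derive g12 g1 => - [_ e1]; case: g2 => _; rewrite e1 => e.
exact: (log_derivative_solve L0 s0 e).
Unshelve. all: by end_near. Qed.

(** With b = <w,phi(0)> and m(t) = (1 - t b) L(t b), the conjugate of [phi_formula] gives m(t)
    (<phi(t w),z> - <phi(0),z>) = t <w,zA> for small t. As m(0) = 1, comparing derivatives at 0
    gives the claim. *)
Lemma jacobian_hermitian z w : dotmx (w *m A) z = dotmx w (z *m A).
Proof.
have B0a : unit_ball (phi 0) by exact: phiB.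
set b := dotmx w (phi 0).
have dm : is_derive (0 : cplx R) 1 (fun t : cplx R => (1 - t * b) * cker (t * b)) 0.
  have d1 : is_derive (0 : cplx R) 1 (fun t : cplx R => 1 - t * b) (- b).
    have d := is_derive_mulr_line b.
    have e := @is_deriveB (cplx R) (cplx R) (cplx R) (cst 1) (fun t : cplx R => t * b) _ _ _ _
      (is_derive_cst _ _ _) d.
    by apply: (is_derive_eq e); rewrite sub0r.
  have e := @is_deriveM _ _ _ _ _ _ _ _ d1 (is_derive_cker_line b).
  apply: (is_derive_eq e).
  by rewrite !mul0r cker0 subr0 !scale1r subrr.
have ds : is_derive (0 : cplx R) 1
    (fun t : cplx R => dotmx (phi (t *: w)) z - dotmx (phi 0) z) (dotmx (w *m A) z).
  have d := is_derive_dotmx_line w z dphi.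
  have e := @is_deriveB (cplx R) (cplx R) (cplx R) _ (cst (dotmx (phi 0) z)) _ _ _ _ d (is_derive_cst _ _ _).
  by apply: (is_derive_eq e); rewrite subr0.
have dms := @is_deriveM _ _ _ _ _ _ _ _ dm ds.
have near_eq : \forall t \near (0 : cplx R),
    ((fun t : cplx R => (1 - t * b) * cker (t * b)) *
     (fun t : cplx R => dotmx (phi (t *: w)) z - dotmx (phi 0) z)) t =
    t * dotmx w (z *m A).
  near=> t.
  have Bt : unit_ball (t *: w) by near: t; exact: near0_unit_ballZ.
  have y1 : `|dotmx (t *: w) (phi 0)| < 1 by exact: (norm_dotmx_lt1 Bt B0a).
  have y2 : `|t * b| < 1 by rewrite /b -(dotmxZl t w (phi 0)).
  have y1' : `|dotmx (phi 0) (t *: w)| < 1 by rewrite dotmxC norm_conjC.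
  have e : dotmx (phi (t *: w)) z =
      dotmx (phi 0) z + ((1 - t * b) * cker (t * b))^-1 * (t * dotmx w (z *m A)).
    (* Conjugation brings phi(t w) to the linear side, so that t itself appears and not its
       conjugate. *)
    rewrite (dotmxC z (phi (t *: w))) (phi_formula z Bt) conjC_affine.
    rewrite -(cker_dlog_conj y1') -(dotmxC (phi 0) (t *: w)).
    rewrite -(dotmxC (z *m A) (t *: w)) -(dotmxC z (phi 0)).
    by rewrite /cker_dlog !dotmxZl.
  apply: linear_solve e; apply: mulf_neq0; last exact: (cker_neq0 y2).
  exact: (Re_gt0_neq0 (Re_subr1_gt0 y2)).
have [_ e1] := near_eq_is_derive near_eq dms.
have [_ e2] := is_derive_mulr_line (dotmx w (z *m A)).
move: e1; rewrite e2 => ->.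
by rewrite /= !mul0r subr0 cker0 mulr1 scale0r subrr scale0r addr0 scale1r.
Unshelve. all: by end_near. Qed.

End functional_equation.

(** * The case where phi does not fix the origin *)

Section jacobian_vanishes.
Variables (R : realType) (N : nat) (phi : 'rV[cplx R]_N -> 'rV[cplx R]_N).

Hypothesis phiB : forall z, unit_ball z -> unit_ball (phi z).
Hypothesis dphi : differentiable phi 0.
Hypothesis cker_eq : forall z w, unit_ball z -> unit_ball w ->
  cker (dotmx z (phi 0)) * cker (dotmx (phi z) w) =
  cker (dotmx (phi 0) w) * cker (dotmx z (phi w)).

Let A := jacobian phi 0.
Let phi_formula := phi_formula phiB dphi cker_eq.
Let jacobian_hermitian := jacobian_hermitian phiB dphi cker_eq.

(** The functional equation at the opposite points z = (s/x0) v and w = -z becomes the equality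
    refuted by [rker_eq_contra] with x = s, y = -s and u = -k s^2. *)
Lemma jacobian_eq0 : phi 0 != 0 -> A = 0.
Proof.
move=> a0; apply/eqP/negPn/negP => A0.
have [v va qv] := exists_positive_direction a0 A0 (fun u v => jacobian_hermitian v u).
have [x0 ea] : exists x0 : R, dotmx v (phi 0) = x0%:C.
  by exists (complex.Re (dotmx v (phi 0))); rewrite RRe_real// ger0_real// ltW.
have [u0 eq] : exists u0 : R, dotmx (v *m A) v = u0%:C.
  exists (complex.Re (dotmx (v *m A) v)); apply: conj_fixed_real.
  by rewrite -(dotmxC (v *m A) v) (jacobian_hermitian v v).
have x0_gt0 : 0 < x0 by rewrite -(@ltcR R 0) -ea.
have u0_neq0 : u0 != 0 by apply: contraNneq qv => u00; rewrite eq u00.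
(* The values of the form and of the squared norm at v/x0, the multiple of v whose product with
   phi(0) is 1. *)
pose k := u0 / x0 ^+ 2; pose V := Normc.normc (dotmx v v) / x0 ^+ 2.
have k0 : k != 0 by rewrite mulf_neq0// invr_neq0 ?expf_neq0 ?gt_eqF.
have V0 : 0 <= V by rewrite divr_ge0 ?normc_nneg ?sqr_ge0.
(* This makes s, s |k| and s V at most 1/2: the first allows [rker_dlog_bounds], the second keeps
   the signs of the shifted arguments, the third keeps z and w in the ball. *)
pose s := (2 * (1 + `|k| + V))^-1.
have m0 : 0 < 2 * (1 + `|k| + V) by have := normr_ge0 k; lra.
have s0 : 0 < s by rewrite invr_gt0.
have s1 : s * (2 * (1 + `|k| + V)) = 1 by rewrite mulVf ?gt_eqF.
clearbody s.
have sk : 0 <= s * `|k| by rewrite mulr_ge0 ?(ltW s0).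
have sV : 0 <= s * V by rewrite mulr_ge0 ?(ltW s0).
have s2 : s <= 2^-1 by lra.
have inB (r : R) : `|r| <= s -> unit_ball ((r / x0)%:C *: v).
  move=> rs; apply: unit_ballZ.
  have -> : dotmx v v = (Normc.normc (dotmx v v))%:C.
    by rewrite -normcEE (ger0_norm (dotmx_ge0 v)).
  have -> : `|(r / x0)%:C : cplx R| = `|r / x0|%:C.
    by rewrite normcEE /= expr0n addr0 sqrtr_sqr.
  rewrite -rmorphXn -rmorphM (@ltcR R _ 1) real_normK ?num_real//.
  have -> : (r / x0) ^+ 2 * Normc.normc (dotmx v v) = `|r| ^+ 2 * V.
    by rewrite real_normK ?num_real// /V expr_div_n mulrAC mulrA.
  have : `|r| ^+ 2 * V <= s ^+ 2 * V by rewrite ler_wpM2r// lerXn2r// nnegrE// ltW.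
  have : s ^+ 2 * V <= 2^-1 * (s * V) by rewrite expr2 -mulrA ler_wpM2r.
  by lra.
pose z := (s / x0)%:C *: v; pose w := (- s / x0)%:C *: v.
have Bz : unit_ball z by apply: inB; rewrite gtr0_norm.
have Bw : unit_ball w by apply: inB; rewrite normrN gtr0_norm.
have za : dotmx z (phi 0) = s%:C.
  by rewrite dotmxZl ea -rmorphM divfK ?gt_eqF.
have aw : dotmx (phi 0) w = (- s)%:C.
  by rewrite dotmxC dotmxZl ea -rmorphM divfK ?gt_eqF// conj_realC.
have zw : dotmx (z *m A) w = (k * s * - s)%:C.
  have -> : k * s * - s = s / x0 * (- s / x0 * u0).
    by rewrite /k; field; rewrite gt_eqF.
  by rewrite -scalemxAl dotmxZl dotmxZr eq conj_realC -!rmorphM.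
have hs : 0 < rker_dlog s <= 2 by apply: rker_dlog_bounds; lra.
have hNs : 0 < rker_dlog (- s) <= 2 by apply: rker_dlog_bounds; lra.
have q_eq : dotmx z (phi w) = (s + rker_dlog (- s) * (k * s * - s))%:C.
  rewrite phi_formula// za aw zw cker_dlog_real; [|lra|lra].
  by rewrite rmorphD [X in _ = _ + X]rmorphM.
have p_eq : dotmx (phi z) w = (- s + rker_dlog s * (k * s * - s))%:C.
  rewrite dotmxC phi_formula//.
  have -> : dotmx (phi 0) z = s%:C by rewrite dotmxC za conj_realC.
  have -> : dotmx w (phi 0) = (- s)%:C by rewrite dotmxC aw conj_realC.
  have -> : dotmx (w *m A) z = (k * s * - s)%:C.
    by rewrite jacobian_hermitian dotmxC zw conj_realC.
  rewrite cker_dlog_real; [|lra|lra].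
  by rewrite -rmorphM -rmorphD conj_realC.
(* The shifted arguments lie in ]-1, 1[ because they are inner products of points of the ball. *)
have lt1 (r : R) : `|r%:C| < 1 :> cplx R -> -1 < r < 1.
  rewrite normc_lt1 /= expr0n addr0 sqrtr_sqr ltr_norml//.
have pN1 := norm_dotmx_lt1 (phiB Bz) Bw; rewrite p_eq in pN1.
have qN1 := norm_dotmx_lt1 Bz (phiB Bw); rewrite q_eq in qN1.
have /andP[p1 p2] := lt1 _ pN1; have /andP[q1 q2] := lt1 _ qN1.
have [s3 s4 s5 s6] : [/\ -1 < s, s < 1, -1 < - s & - s < 1] by split; lra.
have := cker_eq Bz Bw; rewrite za aw p_eq q_eq.
rewrite (cker_real s3 s4) (cker_real s5 s6) (cker_real p1 p2) (cker_real q1 q2).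
rewrite -!rmorphM => /complexI; apply/eqP.
have /andP[hs0 hs2] := hs; have /andP[hNs0 hNs2] := hNs.
have ks : `|k * s| <= 2^-1 by rewrite normrM (gtr0_norm s0) mulrC; lra.
(* From h <= 2 and |k s| <= 1/2, the factors 1 + h k s and 1 - h k s are nonnegative, so the shifts
   do not cross 0. *)
have bound (h : R) : 0 < h -> h <= 2 -> -1 <= h * (k * s) <= 1.
  move=> h0 h2; rewrite -ler_norml normrM (gtr0_norm h0).
  have : h * `|k * s| <= 2 * 2^-1 by rewrite ler_pM// ltW.
  by lra.
have /andP[b1 b2] := bound _ hs0 hs2; have /andP[b3 b4] := bound _ hNs0 hNs2.
have Ns0 : - s < 0 by rewrite oppr_lt0.
apply: (rker_eq_contra s0 s4 s5 Ns0).
- have sn : s != 0 by rewrite gt_eqF.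
  have Nsn : - s != 0 by rewrite oppr_eq0.
  exact: mulf_neq0 (mulf_neq0 k0 sn) Nsn.
- apply/andP; split=> //.
  have -> : - s + rker_dlog s * (k * s * - s) = - (s * (1 + rker_dlog s * (k * s))).
    by ring.
  by rewrite oppr_le0 mulr_ge0 ?(ltW s0)//; lra.
- apply/andP; split=> //.
  have -> : s + rker_dlog (- s) * (k * s * - s) = s * (1 - rker_dlog (- s) * (k * s)).
    by ring.
  by rewrite mulr_ge0 ?(ltW s0)//; lra.
Qed.

End jacobian_vanishes.

Lemma mulf_cancel_eq (F : fieldType) (c s t k l p q : F) : c != 0 ->
  s = c * k -> t = c * l -> s * p = t * q -> k * p = l * q.
Proof. by move=> c0 -> ->; rewrite -!mulrA => /(mulfI c0). Qed.

(** * The two directions of the equivalence *)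

Unset Implicit Arguments.

Theorem theorem3p9 (R : realType) (N : nat) (hN : (0 < N)%N)
    (D : set ('rV[cplx R]_N -> cplx R))
    (ip : ('rV[cplx R]_N -> cplx R) -> ('rV[cplx R]_N -> cplx R) -> cplx R)
    (hD : dirichlet_space D ip)
    (phi : 'rV[cplx R]_N -> 'rV[cplx R]_N)
    (hphi : holomorphic_self_map (@unit_ball R N) phi)
    (psi : 'rV[cplx R]_N -> cplx R)
    (hpsi : holomorphic_on (@unit_ball R N) psi)
    (hW : bounded_operator D ip (weighted_composition psi phi))
    (* without the next two hypotheses the equivalence fails: see psi = 0, and
       the rank one operators f |-> <f, K_a> K_a with a != 0 *)
    (psi_neq0 : exists2 z, unit_ball z & psi z != 0)
    (phi_cst : forall a, (forall z, unit_ball z -> phi z = a) -> a = 0) :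
  hermitian_operator D ip (weighted_composition psi phi) <->
  [/\ exists c : R, forall z, unit_ball z -> psi z = c%:C,
      forall z, unit_ball z -> phi z = (jacobian_matrix phi 0 *m z^T)^T
    & jacobian_matrix phi 0 \is hermsymmx].
Proof.
have [holo_phi phiB] := hphi.
have B0 : unit_ball (0 : 'rV[cplx R]_N) := @unit_ball0 R N.
have dphi : differentiable phi 0 := holo_phi 0 B0.
apply: (iff_trans (hermitian_kernelP hD phiB hW)); split; last first.
  (* Here both sides of the kernel identity are c L(<zA,w>), since <zA,w> = <z,wA>. *)
  case=> -[c psi_c] phi_lin Jherm z w Bz Bw.
  have phiE u : unit_ball u -> phi u = u *m jacobian phi 0.
    by move=> Bu; rewrite (phi_lin u Bu) trmx_mul !trmxK.
  rewrite (psi_c z Bz) (psi_c w Bw) conj_realC (phiE z Bz) (phiE w Bw).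
  by rewrite ((hermsymmx_dotmxP _).1 Jherm z w).
move=> kerE.
set a := phi 0; set c := psi 0.
have kz z : unit_ball z -> psi z = c^* * cker (dotmx z a).
  move=> Bz; have := kerE z 0 Bz B0.
  by rewrite dotmx0r cker0 mulr1.
have cr : c^* = c by rewrite {2}/c (kz 0 B0) dotmx0l cker0 mulr1.
have kw w : unit_ball w -> (psi w)^* = c * cker (dotmx a w).
  move=> Bw; have := kerE 0 w B0 Bw.
  by rewrite dotmx0l cker0 mulr1 => <-.
(* By [kz], c = 0 would make psi vanish on the whole ball. *)
have c0 : c != 0.
  case: psi_neq0 => z Bz; apply: contraNneq => c0.
  by rewrite (kz z Bz) c0 conjC0 mul0r.
have cker_eq z w : unit_ball z -> unit_ball w ->
    cker (dotmx z a) * cker (dotmx (phi z) w) = cker (dotmx a w) * cker (dotmx z (phi w)).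
  move=> Bz Bw; have zc := kz z Bz; rewrite cr in zc.
  exact: (mulf_cancel_eq c0 zc (kw w Bw) (kerE z w Bz Bw)).
have F := phi_formula phiB dphi cker_eq.
have J_herm := jacobian_hermitian phiB dphi cker_eq.
(* If a were nonzero, A = 0 would reduce [phi_formula] to <z,phi(w)> = <z,a>, so phi would be
   constantly a, against [phi_cst]. *)
have a0 : a = 0.
  apply/eqP/negPn/negP => a0; case/eqP: (a0).
  apply: phi_cst => w Bw; apply: dotmx_inj => z.
  by rewrite (F z w Bw) (jacobian_eq0 phiB dphi cker_eq a0) mulmx0 dotmx0l mulr0 addr0.
(* With a = 0 the formula reads <u,phi(z)> = <uA,z>, which is <u,zA> because A is Hermitian. *)
have phiJ z : unit_ball z -> phi z = z *m jacobian phi 0.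
  move=> Bz; apply: dotmx_inj => u.
  by rewrite (F u z Bz) -/a a0 dotmx0r dotmx0l cker_dlog0 mul1r add0r J_herm.
split.
- exists (complex.Re c) => z Bz.
  by rewrite (kz z Bz) a0 dotmx0r cker0 mulr1 cr -conj_fixed_real.
- by move=> z Bz; rewrite (phiJ z Bz) trmx_mul !trmxK.
- by apply/hermsymmx_dotmxP => u v; exact: J_herm.
Qed.
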